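(* Let $\varphi$ be a closed $G_2$ structure on a compact $7$-manifold $M$ with associated metric $g$, let $\psi=*_\varphi\varphi$, and let $X$ be a vector field on $M$. Then $$\mathcal{L}_X\varphi=\frac12 i_\varphi(\mathcal{L}_Xg)+\frac12\big(d^*(X\lrcorner\varphi)\big)^\sharp\lrcorner\psi .$$ In particular, any vector field $X$ with $\mathcal{L}_X\varphi=0$ must be a Killing vector field of $g$ and satisfy $d^*(X\lrcorner\varphi)=0$ on $M$.
   Context: A $G_2$ structure on a $7$-manifold $M$ is a $3$-form $\varphi$ such that for each $x\in M$ there is a linear isomorphism $u:T_xM\to\mathbb{R}^7$ with $u^*\phi=\varphi_x$, where $\phi=e^{123}+e^{145}+e^{167}+e^{246}-e^{257}-e^{347}-e^{356}$. It determines a unique metric $g$ and orientation by $g(u,v)\,vol_g=\frac16(u\lrcorner\varphi)\wedge(v\lrcorner\varphi)\wedge\varphi$, hence a Hodge star $*_\varphi$. It is closed if $d\varphi=0$. For the $3$-form $\phi=e^{123}+e^{145}+e^{167}+e^{246}-e^{257}-e^{347}-e^{356}$ on $\mathbb{R}^7$, with the metric and orientation for which the standard basis $\{e_1,\dots,e_7\}$ (with dual basis $\{e^1,\dots,e^7\}$ and $e^{ijk}=e^i\wedge e^j\wedge e^k$, etc.) is oriented orthonormal, $*_\phi\phi=e^{4567}+e^{2367}+e^{2345}+e^{1357}-e^{1346}-e^{1256}-e^{1247}$. $d^*$ is the formal adjoint of $d$ (so $(d^*\beta)_l=-\nabla^i\beta_{il}$ on $2$-forms), and $\sharp$ is the metric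 isomorphism $T^*M\to TM$. The map $i_\varphi:S^2T^*M\to\Lambda^3T^*M$ is the injective map given locally by $i_\varphi(h)=\frac12h_i^l\varphi_{ljk}\,dx^i\wedge dx^j\wedge dx^k$, where $h=h_{ij}dx^idx^j$ and $\varphi=\frac16\varphi_{ijk}dx^i\wedge dx^j\wedge dx^k$ (so $i_\varphi(g)=3\varphi$). *)

(* Defs.v *)
From HB Require Import structures.
From mathcomp Require Import all_boot all_order all_algebra.
From mathcomp Require Import all_fingroup.
From mathcomp Require Import all_classical all_reals all_analysis.

Set Implicit Arguments.
Unset Strict Implicit.
Unset Printing Implicit Defensive.

Import Order.TTheory GRing.Theory Num.Theory.
Import numFieldNormedType.Exports.

Local Open Scope classical_set_scope.
Local Open Scope ring_scope.

(* A covariant [k]-tensor on an [n]-dimensional vector space with a chosen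
   basis [b_0, ..., b_(n-1)] is given by its values [T (i_1, ..., i_k)] on the
   basis vectors [(b_(i_1), ..., b_(i_k))]. *)

Definition tensor (R : realType) (n k : nat) : Type := k.-tuple 'I_n -> R.

Section PointwiseAlgebra.
Context {R : realType} {n : nat}.

Definition alternating k (T : tensor R n k) : Prop :=
  forall (s : 'S_k) (I : k.-tuple 'I_n),
    T [tuple tnth I (s r) | r < k] = (-1) ^+ s * T I.

(* [dx J] is [dx^(J_1) /\ ... /\ dx^(J_k)], where [dx^0, ..., dx^(n-1)] is the
   dual basis. *)
Definition dx k (J : k.-tuple 'I_n) : tensor R n k :=
  fun I => \det (\matrix_(r < k, s < k) (tnth J r == tnth I s)%:R).

(* The normalization is the one for which
   [dx^(J_1) /\ ... /\ dx^(J_k) = dx J]. *)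
Definition wedge k m (a : tensor R n k) (b : tensor R n m) :
    tensor R n (k + m) :=
  fun I => (k`! * m`!)%:R^-1 *
    \sum_(s : 'S_(k + m)) (-1) ^+ s *
      a [tuple tnth I (s (lshift m r)) | r < k] *
      b [tuple tnth I (s (rshift k r)) | r < m].

(* Interior product [v _| T]. *)
Definition iprod k (v : 'rV[R]_n) (T : tensor R n k.+1) : tensor R n k :=
  fun I => \sum_(l < n) v 0 l * T [tuple of l :: I].

(* Row [i] of [A] contains the components of the image of [b_i] under a linear
   map [u]; the result is [u^* T]. *)
Definition pullback k (A : 'M[R]_n) (T : tensor R n k) : tensor R n k :=
  fun I => \sum_(J : k.-tuple 'I_n)
    (\prod_(r < k) A (tnth I r) (tnth J r)) * T J.

Definition gram (g : tensor R n 2) : 'M[R]_n :=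
  \matrix_(i, j) g [tuple i; j].

Definition gram_inv (g : tensor R n 2) : 'M[R]_n := invmx (gram g).

Definition inner_product (g : tensor R n 2) : Prop :=
  (gram g)^T = gram g /\
  forall v : 'rV[R]_n, v != 0 -> 0 < (v *m gram g *m v^T) 0 0.

(* [vol] is one of the two volume forms of unit length for [g], so that it
   amounts to the choice of an orientation. *)
Definition unit_volume (g : tensor R n 2) (vol : tensor R n n) : Prop :=
  alternating vol /\ vol (ord_tuple n) ^+ 2 = \det (gram g).

Definition sharp (g : tensor R n 2) (a : tensor R n 1) : 'rV[R]_n :=
  \row_i \sum_(j < n) gram_inv g i j * a [tuple j].

Definition raise k (g : tensor R n 2) (w : tensor R n k) : tensor R n k :=
  pullback (gram_inv g) w.

(* [( *w )_J = (1/k!) w^I vol_(I J)]; on a space of dimension [n = k + m] this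
   is the Hodge star determined by [w /\ *w = |w|^2 vol]. *)
Definition hodge k m (g : tensor R n 2) (vol : tensor R n (k + m))
    (w : tensor R n k) : tensor R n m :=
  fun J => k`!%:R^-1 *
    \sum_(I : k.-tuple 'I_n) raise g w I * vol [tuple of I ++ J].

(* [i_phi(h) = (1/2) h_i^l phi_(l j k) dx^i /\ dx^j /\ dx^k]. *)
Definition i_map (g : tensor R n 2) (phi : tensor R n 3) (h : tensor R n 2) :
    tensor R n 3 :=
  fun I => \sum_(i < n) \sum_(j < n) \sum_(k < n)
    2^-1 *
    (\sum_(l < n)
       (\sum_(m < n) h [tuple i; m] * gram_inv g m l) * phi [tuple l; j; k]) *
    dx [tuple i; j; k] I.

End PointwiseAlgebra.

(* [e3 i j k] is [e^(ijk)], with indices counted from 1 to 7. *)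
Definition e3 (R : realType) (i j k : nat) : tensor R 7 3 :=
  dx [tuple inord i.-1; inord j.-1; inord k.-1].

Definition phi0 (R : realType) : tensor R 7 3 := fun I =>
  e3 R 1 2 3 I + e3 R 1 4 5 I + e3 R 1 6 7 I + e3 R 2 4 6 I
  - e3 R 2 5 7 I - e3 R 3 4 7 I - e3 R 3 5 6 I.

(* For open [U]: all the partial derivatives of [f] of order at most [k] exist
   and are continuous on [U]. *)
Fixpoint Ck (R : realType) (n k : nat) (U : set 'rV[R]_n)
    (f : 'rV[R]_n -> R) : Prop :=
  (forall x, U x -> {for x, continuous f}) /\
  match k with
  | 0%N => True
  | k'.+1 => forall i : 'I_n,
      (forall x, U x -> derivable f x (delta_mx 0 i)) /\
      Ck k' U ('D_(delta_mx 0 i) f)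
  end.

Definition smooth_on (R : realType) (n : nat) (U : set 'rV[R]_n)
    (f : 'rV[R]_n -> R) : Prop := forall k, Ck k U f.

(* A (not necessarily maximal) smooth atlas. The maps [crd a] and [inv a] are
   total, but only their restrictions to [dom a] and [crd a @` dom a] matter. *)
Record smooth_atlas (R : realType) (n : nat) (M : topologicalType) := {
  chart : Type;
  dom : chart -> set M;
  crd : chart -> M -> 'rV[R]_n;
  inv : chart -> 'rV[R]_n -> M;
  dom_cover : forall x, exists a, dom a x;
  dom_open : forall a, open (dom a);
  cod_open : forall a, open (crd a @` dom a);
  crdK : forall a x, dom a x -> inv a (crd a x) = x;
  crd_continuous : forall a x, dom a x -> {for x, continuous (crd a)};
  inv_continuous : forall a x, dom a x -> {for crd a x, continuous (inv a)};
  transition_smooth : forall a b (j : 'I_n),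
    smooth_on (crd a @` (dom a `&` dom b)) (fun y => crd b (inv a y) 0 j)
}.

Definition compact_manifold (M : topologicalType) : Prop :=
  [/\ hausdorff_space M, @second_countable M & compact [set: M]].

Section TensorFields.
Context {R : realType} {n : nat} {M : topologicalType}.
Variable A : smooth_atlas R n M.

(* [partial a i f] is [df/dx^i] in the chart [a], as a function on [M]. *)
Definition partial (a : chart A) (i : 'I_n) (f : M -> R) : M -> R :=
  fun x => 'D_(delta_mx 0 i) (f \o inv a) (crd a x).

Definition smooth_in (a : chart A) (f : M -> R) : Prop :=
  smooth_on (crd a @` dom a) (f \o inv a).

(* Row [i] contains the components in the chart [b] of the [i]-th coordinate
   vector field of the chart [a]. *)
Definition jacobian (a b : chart A) (x : M) : 'M[R]_n :=
  \matrix_(i, j) partial a i (fun y => crd b y 0 j) x.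

(* A field is given by its components in every chart [a]; the values outside
   [dom a] are irrelevant. *)
Definition tensor_field (k : nat) : Type := chart A -> M -> tensor R n k.
Definition vector_field : Type := chart A -> M -> 'rV[R]_n.

Definition smooth_tensor_field k (T : tensor_field k) : Prop :=
  (forall a b x, dom a x -> dom b x ->
     T a x =1 pullback (jacobian a b x) (T b x)) /\
  (forall a I, smooth_in a (fun x => T a x I)).

Definition smooth_vector_field (X : vector_field) : Prop :=
  (forall a b x, dom a x -> dom b x ->
     X b x = X a x *m jacobian a b x) /\
  (forall a (i : 'I_n), smooth_in a (fun x => X a x 0 i)).

Definition eq_field k (S T : tensor_field k) : Prop :=
  forall a x, dom a x -> S a x =1 T a x.

Definition vanishes k (T : tensor_field k) : Prop :=
  eq_field T (fun _ _ _ => 0).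

Definition differential_form k (w : tensor_field k) : Prop :=
  smooth_tensor_field w /\ forall a x, dom a x -> alternating (w a x).

Definition riemannian_metric (g : tensor_field 2) : Prop :=
  smooth_tensor_field g /\ forall a x, dom a x -> inner_product (g a x).

(* The volume form of [g] for some orientation of [M]. *)
Definition volume_form (g : tensor_field 2) (vol : tensor_field n) : Prop :=
  differential_form vol /\
  forall a x, dom a x -> unit_volume (g a x) (vol a x).

Definition ext_d k (w : tensor_field k) : tensor_field k.+1 :=
  fun a x I => \sum_(r < k.+1) (-1) ^+ r *
    partial a (tnth I r) (fun y => w a y [tuple tnth I (lift r s) | s < k]) x.

(* Lie bracket, in the chart [a], of the vector fields with components
   [X] and [Y]. *)
Definition lie_bracket (a : chart A) (X Y : M -> 'rV[R]_n) : M -> 'rV[R]_n :=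
  fun x => \row_i \sum_(j < n)
    (X x 0 j * partial a j (fun y => Y y 0 i) x
     - Y x 0 j * partial a j (fun y => X y 0 i) x).

(* The function [T (Y_1, ..., Y_k)] in the chart [a]. *)
Definition eval k (T : tensor_field k) (a : chart A)
    (Y : 'I_k -> M -> 'rV[R]_n) : M -> R :=
  fun x => \sum_(I : k.-tuple 'I_n)
    T a x I * \prod_(r < k) Y r x 0 (tnth I r).

(* The tensor derivation
   [(L_X T) (Y_1, ..., Y_k)
      = X (T (Y_1, ..., Y_k)) - \sum_r T (Y_1, ..., [X, Y_r], ..., Y_k)],
   evaluated on the coordinate vector fields of the chart [a]. *)
Definition lie_derivative k (X : vector_field) (T : tensor_field k) :
    tensor_field k :=
  fun a x I =>
    let Y (r : 'I_k) (_ : M) : 'rV[R]_n := delta_mx 0 (tnth I r) in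
    \sum_(j < n) X a x 0 j * partial a j (eval T a Y) x
    - \sum_(r < k)
        eval T a
          (fun s => if s == r then lie_bracket a (X a) (Y r) else Y s) x.

(* Christoffel symbol [Gamma^p_(i j)] of the Levi-Civita connection of [g]. *)
Definition christoffel (g : tensor_field 2) (a : chart A) (x : M)
    (p i j : 'I_n) : R :=
  2^-1 * \sum_(l < n) gram_inv (g a x) p l *
    (partial a i (fun y => g a y [tuple j; l]) x
     + partial a j (fun y => g a y [tuple i; l]) x
     - partial a l (fun y => g a y [tuple i; j]) x).

(* [nabla_i T_I] *)
Definition cov_deriv k (g : tensor_field 2) (T : tensor_field k)
    (a : chart A) (x : M) (i : 'I_n) : tensor R n k :=
  fun I => partial a i (fun y => T a y I) x
    - \sum_(r < k) \sum_(p < n) christoffel g a x p i (tnth I r) *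
        T a x [tuple if s == r then p else tnth I s | s < k].

(* [(d^* w)_L = - nabla^i w_(i L)] *)
Definition codiff k (g : tensor_field 2) (w : tensor_field k.+1) :
    tensor_field k :=
  fun a x L => - \sum_(i < n) \sum_(j < n) gram_inv (g a x) i j *
    cov_deriv g w a x j [tuple of i :: L].

Definition killing (g : tensor_field 2) (X : vector_field) : Prop :=
  vanishes (lie_derivative X g).

(* [X _| T] *)
Definition iprod_field k (X : vector_field) (T : tensor_field k.+1) :
    tensor_field k :=
  fun a x => iprod (X a x) (T a x).

Definition sharp_field (g : tensor_field 2) (w : tensor_field 1) :
    vector_field :=
  fun a x => sharp (g a x) (w a x).

Definition i_field (g : tensor_field 2) (phi : tensor_field 3)
    (h : tensor_field 2) : tensor_field 3 :=
  fun a x => i_map (g a x) (phi a x) (h a x).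

Definition closed_form k (w : tensor_field k) : Prop := vanishes (ext_d w).

End TensorFields.

Section G2.
Context {R : realType} {M : topologicalType} {A : smooth_atlas R 7 M}.

(* A linear isomorphism [u : T_x M -> R^7] is given in a chart by an invertible
   matrix. *)
Definition G2_structure (phi : tensor_field A 3) : Prop :=
  differential_form phi /\
  forall a x, dom a x ->
    exists2 u : 'M[R]_7, u \in unitmx & phi a x =1 pullback u (phi0 R).

(* [g] and [vol] are the metric and the volume form determined by [phi]:
   [g(u,v) vol = (1/6) (u _| phi) /\ (v _| phi) /\ phi]. *)
Definition G2_metric (phi : tensor_field A 3) (g : tensor_field A 2)
    (vol : tensor_field A 7) : Prop :=
  [/\ riemannian_metric g, volume_form g vol &
    forall a x, dom a x -> forall (u v : 'rV[R]_7) (I : 7.-tuple 'I_7),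
      (u *m gram (g a x) *m v^T) 0 0 * vol a x I
      = 6^-1 *
        wedge (wedge (iprod u (phi a x)) (iprod v (phi a x))) (phi a x)
          I].

(* [*_phi phi] *)
Definition G2_dual (phi : tensor_field A 3) (g : tensor_field A 2)
    (vol : tensor_field A 7) : tensor_field A 4 :=
  fun a x => @hodge R 7 3 4 (g a x) (vol a x) (phi a x).

End G2.

(* Main.v *)
From HB Require Import structures.
From mathcomp Require Import all_boot all_order all_algebra.
From mathcomp Require Import all_fingroup.
From mathcomp Require Import all_classical all_reals all_analysis.
From mathcomp Require Import ring lra.
Require Import Defs.

(* With nabla the Levi-Civita connection of g, L_X phi = nabla_X phi + (nabla X).phi
   and L_X g = (nabla X).g, where an endomorphism of the tangent space acts on
   tensors as a derivation. The identity phi_iab phi_j^ab = 6 g_ij holds at every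
   point; differentiating it shows that the symmetric part of
   (nabla_l phi)_iab phi_j^ab vanishes, hence that nabla_l phi has no component in
   the image of i_phi, i.e. nabla_l phi = T_l _| psi for a 2-tensor T. Since nabla is
   torsion free, d phi = 0 is the vanishing of the alternation of nabla phi, and
   contracting it with psi gives 2 T_lp = - T^iq psi_qlip. This identifies
   nabla_X phi with the part of (1/2) d^*(X _| phi)^# _| psi that involves no
   derivative of X. For the terms in nabla X it remains to check that a skew
   endomorphism W satisfies W.phi = (1/2) v _| psi with v_m = W_ab phi_abm.
   All of this is linear algebra at a point, so that it can be done in a frame where
   phi is phi0; there the contraction identities between phi0 and psi0 are finite
   computations with integers. *)

Set Implicit Arguments.
Unset Strict Implicit.
Unset Printing Implicit Defensive.

Import Order.TTheory GRing.Theory Num.Theory.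
Import numFieldNormedType.Exports.

Local Open Scope ring_scope.

(** * Contractions of phi0 and psi0 *)

(** The matrix [u] with [phi = u^* phi0] is given separately at each point, with no smoothness in
    the point, so it cannot be differentiated. Derivatives are therefore taken in the given chart,
    and the algebraic fact that gets differentiated, phi_iab phi_j^ab = 6 g_ij, mentions no frame:
    it can be verified at every point in a frame of its own. Afterwards nabla phi, X and nabla X are
    plain data [N], [X], [Z] at one point, subject to three tensorial conditions (skewness,
    vanishing alternation, the differentiated identity), and these can be carried to R^7. The claim
    about L_X phi = 0 is the injectivity of (S, v) -> S.phi0 + v _| psi0 for symmetric S, in
    accordance with 35 = 28 + 7: contraction with psi0 recovers v, and then contraction with phi0
    recovers S. The finite checks use integers and natural-number indices because sums over ordinals
    or permutations with values in an abstract field do not evaluate. *)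

Definition sum7 (F : nat -> int) : int :=
  F 0%N + (F 1%N + (F 2%N + (F 3%N + (F 4%N + (F 5%N + F 6%N))))).

Definition all7 (P : nat -> bool) : bool := all P (iota 0 7).

Lemma all7P (P : nat -> bool) : all7 P -> forall i : 'I_7, P i.
Proof. by move=> /allP h i; apply: h; rewrite mem_iota ltn_ord. Qed.

Lemma sum7E (R : pzRingType) (F : nat -> int) :
  \sum_(i < 7) (F i)%:~R = (sum7 F)%:~R :> R.
Proof. by rewrite !big_ord_recl big_ord0 /sum7 !rmorphD /= addr0. Qed.

Definition sum_int (F : nat -> int) (n : nat) : int :=
  foldr (fun s acc => F s + acc) 0 (iota 0 n).

Definition sign_int (s : nat) : int := if odd s then -1 else 1.

Definition remove_at (T : Type) (s : nat) (I : seq T) := take s I ++ drop s.+1 I.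

(** Laplace expansion along the first row of the 0-1 matrix with entries [J_r = I_s]; zero entries
    are not followed. This is [dx] in a form that evaluates ([dx_seq]). *)
Fixpoint det_seq (J I : seq nat) : int :=
  if J is x :: J' then
    sum_int (fun s => if nth 0%N I s
      == x then sign_int s * det_seq J' (remove_at s I) else 0)
      (size I)
  else 1.

Definition phi_int (i j k : nat) : int :=
  let e a b c := det_seq [:: a; b; c] [:: i; j; k] in
  e 0%N 1%N 2%N + e 0%N 3%N 4%N + e 0%N 5%N 6%N + e 1%N 3%N 5%N
  - e 1%N 4%N 6%N - e 2%N 3%N 6%N - e 2%N 4%N 5%N.

(* Tabulated, so that the finite checks below reduce to list lookups. *)
Definition phi_table : seq (seq (seq int)) :=
  Eval vm_compute in
  [seq [seq [seq phi_int i j k | k <- iota 0 7] | j <- iota 0 7] | i <- iota 0 7].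

Definition phi_coef (i j k : nat) : int := nth 0 (nth [::] (nth [::] phi_table i) j) k.

Definition kron_int (i j : nat) : int := if i == j then 1 else 0.

(* psi_ijkl, solved from phi_ijb phi_klb = d_ik d_jl - d_il d_jk + psi_ijkl. *)
Definition psi_int (i j k l : nat) : int :=
  sum7 (fun b => phi_coef i j b * phi_coef k l b) - kron_int i k * kron_int j l
    + kron_int i l * kron_int j k.

Definition psi_table : seq (seq (seq (seq int))) :=
  Eval vm_compute in
  [seq [seq [seq [seq psi_int i j k l | l <- iota 0 7] | k <- iota 0 7]
      | j <- iota 0 7] | i <- iota 0 7].

Definition psi_coef (i j k l : nat) : int :=
  nth 0 (nth [::] (nth [::] (nth [::] psi_table i) j) k) l.

Lemma all7_2 (P : nat -> nat -> bool) :
  all7 (fun i => all7 (P i)) -> forall i j : 'I_7, P i j.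
Proof. by move=> h i; apply: all7P; move: i; apply: (all7P h). Qed.

Lemma all7_3 (P : nat -> nat -> nat -> bool) :
  all7 (fun i => all7 (fun j => all7 (P i j))) -> forall i j k : 'I_7, P i j k.
Proof.
by move=> h i; apply: (@all7_2 (P i)); move: i; apply: (all7P h).
Qed.

Lemma all7_4 (P : nat -> nat -> nat -> nat -> bool) :
  all7 (fun i => all7 (fun j => all7 (fun k => all7 (P i j k)))) ->
  forall i j k l : 'I_7, P i j k l.
Proof.
by move=> h i; apply: (@all7_3 (P i)); move: i; apply: (all7P h).
Qed.

Lemma all7_5 (P : nat -> nat -> nat -> nat -> nat -> bool) :
  all7 (fun i => all7 (fun j => all7 (fun k => all7 (fun l => all7 (P i j k l))))) ->
  forall i j k l m : 'I_7, P i j k l m.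
Proof.
by move=> h i; apply: (@all7_4 (P i)); move: i; apply: (all7P h).
Qed.

Lemma all7_6 (P : nat -> nat -> nat -> nat -> nat -> nat -> bool) :
  all7 (fun i => all7 (fun j =>
    all7 (fun k => all7 (fun l => all7 (fun m => all7 (P i j k l m)))))) ->
  forall i j k l m n : 'I_7, P i j k l m n.
Proof.
by move=> h i; apply: (@all7_5 (P i)); move: i; apply: (all7P h).
Qed.

Lemma phi_coefE (i j k : 'I_7) : phi_coef i j k = phi_int i j k.
Proof.
apply/eqP.
by refine (@all7_3 (fun i j k => phi_coef i j k == phi_int i j k) _ i j k); vm_compute.
Qed.

Definition asym (I : Type) (V : zmodType) (c : I -> I -> I -> V) a b d : V :=
  (c a b d + c b d a + c d a b) - (c b a d + c a d b + c d b a).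

(* For an alternating n with S_ij = n_iab phi_jab + phi_iab n_jab, the form n is the sum
   of h.phi, where h = S / 8 - (tr S / 72) d, and of its projection
   (1/24) (n_abd psi_mabd) psi_mijk. This is 72 times the coefficient of n_abd in the
   difference of the two sides at ijk. *)
Definition proj7_coef (i j k a b d : nat) : int :=
  72 * (kron_int i a * (kron_int j b * kron_int k d))
  - 9 * ((kron_int i a * (kron_int b j * kron_int d k - kron_int b k * kron_int d j
    + psi_coef b d j k)
            + phi_coef i b d * phi_coef a j k)
         - (kron_int j a * (kron_int b i * kron_int d k - kron_int b k * kron_int d i
           + psi_coef b d i k)
            + phi_coef j b d * phi_coef a i k)
         + (kron_int k a * (kron_int b i * kron_int d j - kron_int b j * kron_int d i
           + psi_coef b d i j)
            + phi_coef k b d * phi_coef a i j))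
  + 6 * (phi_coef i j k * phi_coef a b d)
  - 3 * sum7 (fun m => psi_coef m i j k * psi_coef m a b d).

(** An alternating n sees only the antisymmetrization of a coefficient array, and the identity to be
    proved is itself alternating in i, j, k, so increasing triples on both sides suffice. The
    conditional inside the check limits the expensive branch to 35 * 35 of the 7^6 cases. *)
Lemma asym_proj7_coef (i j k a b d : 'I_7) : (i < j < k)%N -> (a < b < d)%N ->
  asym (proj7_coef i j k) a b d = 0.
Proof.
move=> ijk abd.
have h : if (i < j < k)%N && (a < b < d)%N
    then asym (proj7_coef i j k) a b d == 0 else true.
  by refine (@all7_6 (fun i j k a b d =>
    if (i < j < k)%N && (a < b < d)%N
    then asym (proj7_coef i j k) a b d == 0 else true) _ i j k a b d); vm_compute.
by case: ifP h => [_ /eqP|] //; rewrite ijk abd.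
Qed.

Lemma sum_delta (R : pzSemiRingType) n (i : 'I_n) (G : 'I_n -> R) :
  \sum_p (i == p)%:R * G p = G i.
Proof.
rewrite (bigD1 i) //= eqxx mul1r big1 ?addr0 // => p.
by rewrite eq_sym => /negbTE ->; rewrite mul0r.
Qed.

Lemma sum_deltaC (R : pzSemiRingType) n (i : 'I_n) (G : 'I_n -> R) :
  \sum_p (p == i)%:R * G p = G i.
Proof. by under eq_bigr do rewrite eq_sym; rewrite sum_delta. Qed.

(** * Arrays alternating in three indices *)

Definition alt3 (T : Type) (R : zmodType) (f : T -> T -> T -> R) :=
  (forall i j k, f i j k = - f j i k) /\ (forall i j k, f i j k = - f i k j).

Section Alternating3.
Variable R : numFieldType.
Variables (n : nat) (f : 'I_n -> 'I_n -> 'I_n -> R).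
Hypothesis alt_f : alt3 f.

Lemma oppr_eq_self (x : R) : x = - x -> x = 0.
Proof.
move=> /eqP; rewrite -addr_eq0 -mulr2n mulrn_eq0 /=.
by move/eqP.
Qed.

Lemma alt3_13 i j k : f i j k = - f k j i.
Proof. by rewrite alt_f.1 alt_f.2 alt_f.1 opprK. Qed.

Lemma alt3_cycle i j k : f i j k = f j k i.
Proof. by rewrite alt_f.1 alt_f.2 opprK. Qed.

Lemma alt3_sorted_eq0 :
  (forall i j k : 'I_n, (i < j < k)%N -> f i j k = 0) -> forall i j k, f i j k = 0.
Proof.
move=> h.
have h0 (a b c : 'I_n) : (a < b)%N -> f a b c = 0.
  move=> ab; case: (ltngtP b c) => [bc|cb|/val_inj ->]; first exact/h/andP.
    rewrite alt_f.2; case: (ltngtP a c) => [ac|ca|/val_inj ->].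
    - by rewrite h ?oppr0 // ac.
    - by rewrite alt_f.1 h ?oppr0 // ca.
    - by rewrite [f c c b]oppr_eq_self ?oppr0 // {1}alt_f.1.
  by apply: oppr_eq_self; rewrite {1}alt_f.2.
move=> i j k; case: (ltngtP i j) => [|ji|/val_inj ->]; first exact: h0.
  by rewrite alt_f.1 h0 ?oppr0.
by apply: oppr_eq_self; rewrite {1}alt_f.1.
Qed.

End Alternating3.

(** * Contraction identities in an orthonormal frame *)

Section Contractions.
Variable R : numFieldType.

Definition phi_comp (i j k : 'I_7) : R := (phi_coef i j k)%:~R.
Definition psi_comp (i j k l : 'I_7) : R := (psi_coef i j k l)%:~R.
Definition kron (i j : 'I_7) : R := (i == j)%:R.

Lemma kronE i j : kron i j = (kron_int i j)%:~R.
Proof. by rewrite /kron /kron_int -val_eqE /=; case: eqP. Qed.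

Lemma phi_comp_swap12 i j k : phi_comp i j k = - phi_comp j i k.
Proof.
rewrite /phi_comp -rmorphN /=; congr _%:~R; apply/eqP.
by refine (@all7_3 (fun i j k => phi_coef i j k == - phi_coef j i k) _ i j k); vm_compute.
Qed.

Lemma phi_comp_swap23 i j k : phi_comp i j k = - phi_comp i k j.
Proof.
rewrite /phi_comp -rmorphN /=; congr _%:~R; apply/eqP.
by refine (@all7_3 (fun i j k => phi_coef i j k == - phi_coef i k j) _ i j k); vm_compute.
Qed.

Lemma psi_comp_swap23 i j k l : psi_comp i j k l = - psi_comp i k j l.
Proof.
rewrite /psi_comp -rmorphN /=; congr _%:~R; apply/eqP.
by refine (@all7_4 (fun i j k l => psi_coef i j k l == - psi_coef i k j l) _ i j k l);
  vm_compute.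
Qed.

Lemma psi_comp_swap34 i j k l : psi_comp i j k l = - psi_comp i j l k.
Proof.
rewrite /psi_comp -rmorphN /=; congr _%:~R; apply/eqP.
by refine (@all7_4 (fun i j k l => psi_coef i j k l == - psi_coef i j l k) _ i j k l);
  vm_compute.
Qed.

(** The cross product identity of the octonions. [psi_coef] is tabulated from this very formula;
    that it gives the Hodge dual of phi0 is the content of [psi0E]. *)
Lemma contract_phi_phi i m j a :
  \sum_b phi_comp i m b * phi_comp j a b = kron i j * kron m a - kron i a * kron m j
    + psi_comp i m j a.
Proof.
rewrite !kronE /phi_comp /psi_comp; under eq_bigr do rewrite -intrM.
rewrite (sum7E _ (fun b => phi_coef i m b * phi_coef j a b)).
rewrite -!intrM -rmorphB -rmorphD /=; congr _%:~R; apply/eqP.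
by refine (@all7_4 (fun i m j a => sum7 (fun b => phi_coef i m b * phi_coef j a b)
  == kron_int i j * kron_int m a - kron_int i a * kron_int m j
    + psi_coef i m j a) _ i m j a); vm_compute.
Qed.

(** The right-hand side is the derivation action on phi of the elementary skew endomorphism e_a /\
    e_b; hence so(7) moves phi only in directions of the form v _| psi. *)
Lemma contract_phi_psi a b i j k :
  \sum_m phi_comp a b m * psi_comp m i j k =
    kron i a * phi_comp b j k - kron i b * phi_comp a j k
      + (kron j a * phi_comp i b k - kron j b * phi_comp i a k)
    + (kron k a * phi_comp i j b - kron k b * phi_comp i j a).
Proof.
rewrite !kronE /phi_comp /psi_comp; under eq_bigr do rewrite -intrM.
rewrite (sum7E _ (fun m => phi_coef a b m * psi_coef m i j k)).
rewrite -!intrM -!rmorphB -!rmorphD /=; congr _%:~R; apply/eqP.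
by refine (@all7_5 (fun a b i j k => sum7 (fun m => phi_coef a b m * psi_coef m i j k)
  == kron_int i a * phi_coef b j k - kron_int i b * phi_coef a j k
    + (kron_int j a * phi_coef i b k - kron_int j b * phi_coef i a k)
    + (kron_int k a * phi_coef i j b - kron_int k b * phi_coef i j a)) _ a b i j k);
      vm_compute.
Qed.

Lemma contract2_phi_psi m q i :
  \sum_j \sum_k phi_comp m j k * psi_comp q i j k = 4 * phi_comp m q i.
Proof.
rewrite /phi_comp /psi_comp; under eq_bigr => j _.
  under eq_bigr do rewrite -intrM.
  rewrite (sum7E _ (fun k => phi_coef m j k * psi_coef q i j k)); over.
rewrite (sum7E _ (fun j => sum7 (fun k => phi_coef m j k * psi_coef q i j k))).
rewrite -[4]/(4%:~R) -intrM; congr _%:~R; apply/eqP.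
by refine (@all7_3 (fun m q i =>
  sum7 (fun j => sum7 (fun k => phi_coef m j k * psi_coef q i j k))
    == 4 * phi_coef m q i) _ m q i); vm_compute.
Qed.

Lemma contract2_psi_psi m l q i :
  \sum_j \sum_k psi_comp m l j k * psi_comp q i j k =
    4 * (kron m q * kron l i) - 4 * (kron m i * kron l q) + 2 * psi_comp m l q i.
Proof.
rewrite !kronE /psi_comp; under eq_bigr => j _.
  under eq_bigr do rewrite -intrM.
  rewrite (sum7E _ (fun k => psi_coef m l j k * psi_coef q i j k)); over.
rewrite (sum7E _ (fun j => sum7 (fun k => psi_coef m l j k * psi_coef q i j k))).
rewrite -[4]/(4%:~R) -[2]/(2%:~R) -!intrM -rmorphB -rmorphD /=; congr _%:~R; apply/eqP.
by refine (@all7_4 (fun m l q i =>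
  sum7 (fun j => sum7 (fun k => psi_coef m l j k * psi_coef q i j k)) ==
  4 * (kron_int m q * kron_int l i) - 4 * (kron_int m i * kron_int l q)
    + 2 * psi_coef m l q i) _ m l q i); vm_compute.
Qed.

Lemma contract3_psi_psi m q :
  \sum_i \sum_j \sum_k psi_comp m i j k * psi_comp q i j k = 24 * kron m q.
Proof.
rewrite !kronE /psi_comp; under eq_bigr => i _.
  under eq_bigr => j _.
    under eq_bigr do rewrite -intrM.
    rewrite (sum7E _ (fun k => psi_coef m i j k * psi_coef q i j k)); over.
  rewrite (sum7E _ (fun j => sum7 (fun k => psi_coef m i j k * psi_coef q i j k))); over.
rewrite (sum7E _ (fun i => sum7 (fun j => sum7 (fun k =>
  psi_coef m i j k * psi_coef q i j k)))).
rewrite -[24]/(24%:~R) -!intrM /=; congr _%:~R; apply/eqP.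
by refine (@all7_2 (fun m q => sum7 (fun i => sum7 (fun j => sum7 (fun k =>
  psi_coef m i j k * psi_coef q i j k))) == 24 * kron_int m q) _ m q); vm_compute.
Qed.

Lemma alt3_phi : alt3 phi_comp.
Proof. by split=> i j k; [exact: phi_comp_swap12 | exact: phi_comp_swap23]. Qed.

Lemma alt3_psi m : alt3 (psi_comp m).
Proof. by split=> i j k; [exact: psi_comp_swap23 | exact: psi_comp_swap34]. Qed.

(** * Projection of a 3-form to the summand of forms v _| psi *)

Section Pairing.
Variable n : 'I_7 -> 'I_7 -> 'I_7 -> R.
Hypothesis alt_n : alt3 n.

(** Every term of the projection formula is linear in n, hence is the pairing of n with some array
    of coefficients; this moves the whole formula to arrays with integer entries. *)
Let pr (c : 'I_7 -> 'I_7 -> 'I_7 -> R) := \sum_a \sum_b \sum_d n a b d * c a b d.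

Let pr_eq c c' : (forall a b d, c a b d = c' a b d) -> pr c = pr c'.
Proof.
by move=> h; apply: eq_bigr => a _; apply: eq_bigr => b _; apply: eq_bigr => d _;
  rewrite h.
Qed.

Let prD c c' : pr (fun a b d => c a b d + c' a b d) = pr c + pr c'.
Proof.
rewrite -big_split; apply: eq_bigr => a _; rewrite -big_split; apply: eq_bigr => b _.
by rewrite -big_split; apply: eq_bigr => d _; rewrite mulrDr.
Qed.

Let prZ x c : pr (fun a b d => x * c a b d) = x * pr c.
Proof.
rewrite mulr_sumr; apply: eq_bigr => a _; rewrite mulr_sumr; apply: eq_bigr => b _.
by rewrite mulr_sumr; apply: eq_bigr => d _; rewrite mulrCA.
Qed.

Let prN c : pr (fun a b d => - c a b d) = - pr c.
Proof. by rewrite -mulN1r -prZ; apply: pr_eq => a b d; rewrite mulN1r. Qed.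

Let pr_sum (c : 'I_7 -> 'I_7 -> 'I_7 -> 'I_7 -> R) :
  pr (fun a b d => \sum_p c p a b d) = \sum_p pr (c p).
Proof.
rewrite /pr [RHS]exchange_big; apply: eq_bigr => a _; rewrite [RHS]exchange_big.
apply: eq_bigr => b _; rewrite [RHS]exchange_big; apply: eq_bigr => d _.
by rewrite mulr_sumr.
Qed.

Let pr_lin (u : 'I_7 -> R) (c : 'I_7 -> 'I_7 -> 'I_7 -> 'I_7 -> R) :
  \sum_p u p * pr (c p) = pr (fun a b d => \sum_p u p * c p a b d).
Proof. by rewrite pr_sum; apply: eq_bigr => p _; rewrite prZ. Qed.

Let pr_12 c : pr (fun a b d => c b a d) = - pr c.
Proof.
rewrite -prN /pr exchange_big; apply: eq_bigr => a _; apply: eq_bigr => b _.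
by apply: eq_bigr => d _; rewrite alt_n.1 mulNr mulrN.
Qed.

Let pr_23 c : pr (fun a b d => c a d b) = - pr c.
Proof.
rewrite -prN; apply: eq_bigr => a _; rewrite exchange_big; apply: eq_bigr => b _.
by apply: eq_bigr => d _; rewrite alt_n.2 mulNr mulrN.
Qed.

Lemma asym_intr I (c : I -> I -> I -> int) a b d :
  asym (fun a b d => (c a b d)%:~R : R) a b d = (asym c a b d)%:~R.
Proof. by rewrite /asym !(rmorphB, rmorphD). Qed.

Lemma alt3_asym (c : 'I_7 -> 'I_7 -> 'I_7 -> R) : alt3 (asym c).
Proof. by split=> i j k; rewrite /asym; ring. Qed.

(** As n is alternating, each of the six signed permutations of an array pairs with it to the same
    value. *)
Let pr_asym c : pr (asym c) = 6 * pr c.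
Proof.
rewrite /asym prD prN !prD.
have e1 : pr (fun a b d => c b d a) = pr c.
  apply: etrans (pr_12 (fun a b d => c a d b)) _.
  by rewrite (pr_23 c) opprK.
have e3 : pr (fun a b d => c d b a) = - pr c.
  by apply: etrans (pr_23 (fun a b d => c b d a)) _; rewrite e1.
have e2 : pr (fun a b d => c d a b) = pr c.
  by apply: etrans (pr_12 (fun a b d => c d b a)) _; rewrite e3 opprK.
by rewrite e1 e2 e3 (pr_12 c) (pr_23 c); ring.
Qed.

(** Let S be the symmetric 2-tensor in the hypothesis. For n = h.phi it equals 8 h + 4 (tr h) d,
    while for n = v _| psi it vanishes, because n_iab phi_jab = 4 v_q phi_jqi is skew in i, j. So S
    = 0 leaves only the second summand, and 1/24 inverts psi_mabd psi_qabd = 24 d_mq. Solving the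
    first relation for h gives the factors 1/8 and 1/72 behind [proj7_coef]. *)
Lemma alt3_in_Lambda7 :
  (forall i j, \sum_a \sum_b (n i a b * phi_comp j a b + phi_comp i a b * n j a b) = 0) ->
  forall i j k, n i j k =
    \sum_m (24^-1 * \sum_a \sum_b \sum_d n a b d * psi_comp m a b d) * psi_comp m i j k.
Proof.
move=> S0.
(* The Kronecker factor turns the free index of n_iab into a summation index, so that the hypothesis
   becomes the vanishing of a pairing. *)
have cS i p : pr (fun a b d => kron i a * phi_comp p b d + kron p a * phi_comp i b d) = 0.
  have e q r : pr (fun a b d => kron q a * phi_comp r b d)
    = \sum_a \sum_b n q a b * phi_comp r a b.
    rewrite /pr -[RHS](sum_delta q (fun a => \sum_b \sum_d n a b d * phi_comp r b d)).
    apply: eq_bigr => a _; rewrite mulr_sumr; apply: eq_bigr => b _.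
    by rewrite mulr_sumr; apply: eq_bigr => d _; rewrite mulrCA.
  rewrite prD !e -[RHS](S0 i p) -big_split; apply: eq_bigr => a _ /=.
  by rewrite -big_split; apply: eq_bigr => b _ /=; congr (_ + _); exact: mulrC.
(* The trace of the hypothesis is 2 n_abd phi_abd. *)
have trS : pr phi_comp = 0.
  have: \sum_i pr (fun a b d => kron i a * phi_comp i b d + kron i a * phi_comp i b d)
    = 0.
    by apply: big1 => i _; exact: cS.
  rewrite -pr_sum; under [LHS]pr_eq => a b d.
    by rewrite big_split /= (sum_deltaC a (fun i => phi_comp i b d)) over.
  by rewrite prD -mulr2n => /eqP; rewrite mulrn_eq0 /= => /eqP.
pose E i j k := n i j k -
  \sum_m (24^-1 * \sum_a \sum_b \sum_d n a b d * psi_comp m a b d) * psi_comp m i j k.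
suff E0 i j k : E i j k = 0 by move=> i j k; apply/eqP; rewrite -subr_eq0; apply/eqP/E0.
move: i j k; apply: alt3_sorted_eq0.
  split=> i j k; rewrite /E.
    rewrite alt_n.1 opprB [RHS]addrC -sumrN; congr (_ + _); apply: eq_bigr => m _.
    by rewrite psi_comp_swap23 mulrN opprK.
  rewrite alt_n.2 opprB [RHS]addrC -sumrN; congr (_ + _); apply: eq_bigr => m _.
  by rewrite psi_comp_swap34 mulrN opprK.
move=> i j k ijk.
have K0 : pr (fun a b d => (proj7_coef i j k a b d)%:~R) = 0.
  have h : 6 * pr (fun a b d => (proj7_coef i j k a b d)%:~R) = 0.
    apply: etrans (esym (pr_asym _)) _; rewrite /pr; apply: big1 => a _;
      apply: big1 => b _; apply: big1 => d _.
    rewrite (alt3_sorted_eq0 (alt3_asym _)) ?mulr0 // => {}a {}b {}d abd.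
    apply: (@etrans _ _ (asym (proj7_coef i j k) a b d)%:~R).
      exact: asym_intr.
    by rewrite asym_proj7_coef.
  by move/eqP: h; rewrite mulf_eq0 pnatr_eq0 /= => /eqP.
have cSF p q r a b d : \sum_m phi_comp m q r * (kron p a * phi_comp m b d
  + kron m a * phi_comp p b d) =
    kron p a * (kron b q * kron d r - kron b r * kron d q + psi_comp b d q r)
      + phi_comp p b d * phi_comp a q r.
  under eq_bigr do rewrite mulrDr.
  rewrite big_split /=; congr (_ + _).
    rewrite -contract_phi_phi mulr_sumr; apply: eq_bigr => m _.
    by rewrite (alt3_cycle alt3_phi m) (alt3_cycle alt3_phi m b); ring.
  rewrite -(sum_deltaC a (fun m => phi_comp p b d * phi_comp m q r));
    apply: eq_bigr => m _.
  by rewrite /kron; ring.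
(* The array unpacked: 72 times n minus h.phi minus the projection, with tr S written as 2 n_abd
   phi_abd. *)
have key : pr (fun a b d => (proj7_coef i j k a b d)%:~R) =
    72 * n i j k - 9 * ((\sum_m phi_comp m j k * pr (fun a b d =>
      kron i a * phi_comp m b d + kron m a * phi_comp i b d))
     - (\sum_m phi_comp m i k * pr (fun a b d => kron j a * phi_comp m b d
       + kron m a * phi_comp j b d))
     + (\sum_m phi_comp m i j * pr (fun a b d => kron k a * phi_comp m b d
       + kron m a * phi_comp k b d)))
    + 6 * (phi_comp i j k * pr phi_comp) - 3 * \sum_m psi_comp m i j k * pr (psi_comp m).
  have -> : n i j k = pr (fun a b d => kron i a * (kron j b * kron k d)).
    rewrite -(sum_delta i (fun a => n a j k)); apply: eq_bigr => a _.
    rewrite -(sum_delta j (fun b => n a b k)) mulr_sumr; apply: eq_bigr => b _.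
    rewrite -(sum_delta k (fun d => n a b d)) !mulr_sumr; apply: eq_bigr => d _.
    by rewrite /kron; ring.
  rewrite !pr_lin -!(prZ, prN, prD).
  apply: pr_eq => a b d; rewrite !cSF /proj7_coef /phi_comp /psi_comp.
  under eq_bigr do rewrite -intrM.
  rewrite (sum7E _ (fun m => psi_coef m i j k * psi_coef m a b d)) !kronE.
  by rewrite !(intrD, intrM, intrB, intrN) -?pmulrn.
have z p q r :
    \sum_m phi_comp m q r * pr (fun a b d => kron p a * phi_comp m b d
      + kron m a * phi_comp p b d) = 0.
  by apply: big1 => m _; rewrite cS mulr0.
move: key; rewrite K0 trS !z subrr add0r !mulr0 subr0 addr0 => /esym/eqP;
  rewrite subr_eq0 => /eqP key.
rewrite /E; apply/eqP; rewrite subr_eq0; apply/eqP.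
have -> : n i j k = 72^-1 * (72 * n i j k) by field.
rewrite key mulrA mulr_sumr; apply: eq_bigr => m _; rewrite /pr.
by field.
Qed.

End Pairing.

(** * Endomorphisms acting on phi0, and the identity in an adapted frame *)

Definition deriv_phi0 (W : 'I_7 -> 'I_7 -> R) i j k :=
  \sum_p (W i p * phi_comp p j k + W j p * phi_comp i p k + W k p * phi_comp i j p).

(** The conclusion is the equation of the summand g2 among 2-tensors: T_im psi_lpim = -2 T_lp, which
    makes T skew. When the hypothesis is contracted with psi_pijk, its last three terms agree after
    relabelling, so that 24 T = 3 U; and the contraction of psi with psi evaluates U as 4 T - 4 (tr
    T) d - 2 T_im psi_mlip. *)
Lemma torsion_in14 (T : 'I_7 -> 'I_7 -> R) :
  (forall l i j k, \sum_m T l m * psi_comp m i j k - \sum_m T i m * psi_comp m l j k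
     + \sum_m T j m * psi_comp m l i k - \sum_m T k m * psi_comp m l i j = 0) ->
  forall l p, 2 * T l p + \sum_i \sum_m T i m * psi_comp m l i p = 0.
Proof.
move=> cl.
pose U l p := \sum_i \sum_j \sum_k (\sum_m T i m * psi_comp m l j k) * psi_comp p i j k.
have UE l p : U l p = 4 * T l p - 4 * (kron l p * \sum_i T i i)
    - 2 * \sum_i \sum_m T i m * psi_comp m l i p.
  rewrite /U.
  transitivity (\sum_i \sum_m T i m * (4 * (kron m p * kron l i)
    - 4 * (kron m i * kron l p)
      + 2 * psi_comp m l p i)).
    apply: eq_bigr => i _; under eq_bigr => j _.
      under eq_bigr do rewrite mulr_suml; rewrite exchange_big /=; over.
    rewrite exchange_big /=; apply: eq_bigr => m _; rewrite -contract2_psi_psi mulr_sumr.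
    apply: eq_bigr => j _; rewrite mulr_sumr; apply: eq_bigr => k _.
    by rewrite mulrA.
  transitivity (4 * (\sum_i kron l i * \sum_m kron m p * T i m)
     - 4 * (kron l p * \sum_i \sum_m kron m i * T i m)
     - 2 * \sum_i \sum_m T i m * psi_comp m l i p).
    rewrite !mulr_sumr -!sumrB; apply: eq_bigr => i _.
    rewrite !mulr_sumr -!sumrB; apply: eq_bigr => m _.
    by rewrite (psi_comp_swap34 m l p i); ring.
  rewrite (sum_delta l (fun i => \sum_m kron m p * T i m)) (sum_deltaC p (T l)).
  by under [\sum_i \sum_m kron m i * _]eq_bigr => i _ do rewrite (sum_deltaC i (T i)).
have key l p : 24 * T l p - 3 * U l p = 0.
  transitivity (\sum_i \sum_j \sum_k (\sum_m T l m * psi_comp m i j k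
    - \sum_m T i m * psi_comp m l j k
     + \sum_m T j m * psi_comp m l i k
       - \sum_m T k m * psi_comp m l i j) * psi_comp p i j k); last first.
    by rewrite big1 // => i _; rewrite big1 // => j _; rewrite big1 // => k _;
      rewrite cl mul0r.
  under eq_bigr => i _ do under eq_bigr => j _ do under eq_bigr => k _ do
    rewrite mulrBl mulrDl mulrBl.
  under eq_bigr => i _ do under eq_bigr => j _ do rewrite sumrB big_split sumrB /=.
  under eq_bigr => i _ do rewrite sumrB big_split sumrB /=.
  rewrite sumrB big_split sumrB /=.
  have -> : \sum_i \sum_j \sum_k (\sum_m T l m * psi_comp m i j k) * psi_comp p i j k
    = 24 * T l p.
    transitivity (\sum_m T l m * (24 * kron m p)); last first.
      rewrite -[in RHS](sum_deltaC p (T l)) mulr_sumr; apply: eq_bigr => m _.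
      by rewrite /kron; ring.
    under [RHS]eq_bigr do rewrite -contract3_psi_psi mulr_sumr.
    rewrite [RHS]exchange_big; apply: eq_bigr => i _.
    under [RHS]eq_bigr do rewrite mulr_sumr.
    rewrite [RHS]exchange_big; apply: eq_bigr => j _.
    under [RHS]eq_bigr do rewrite mulr_sumr.
    rewrite [RHS]exchange_big; apply: eq_bigr => k _.
    by rewrite mulr_suml; apply: eq_bigr => m _; rewrite mulrA.
  have -> : \sum_i \sum_j \sum_k (\sum_m T j m * psi_comp m l i k) * psi_comp p i j k =
    - U l p.
    rewrite exchange_big -sumrN; apply: eq_bigr => i _; rewrite -sumrN.
    apply: eq_bigr => j _; rewrite -sumrN; apply: eq_bigr => k _.
    by rewrite psi_comp_swap23 mulrN.
  have -> : \sum_i \sum_j \sum_k (\sum_m T k m * psi_comp m l i j) * psi_comp p i j k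
    = U l p.
    under eq_bigr => i _ do rewrite exchange_big.
    rewrite exchange_big; apply: eq_bigr => i _; apply: eq_bigr => j _.
    by apply: eq_bigr => k _; rewrite (alt3_cycle (alt3_psi p) i).
  by rewrite -/(U l p); ring.
(* On the diagonal psi_mlil = 0 removes the psi term, so the trace t satisfies 24 t - 3 (4 t - 28 t)
   = 96 t = 0. *)
have tr0 : \sum_i T i i = 0.
  have: \sum_i (24 * T i i - 3 * U i i) = 0 by apply: big1 => i _; exact: key.
  under eq_bigr => l _.
    rewrite UE [\sum_i \sum_m _](_ : _ = 0); last first.
      apply: big1 => i _; apply: big1 => m _.
      have -> : psi_comp m l i l = 0; last by rewrite mulr0.
      by apply: oppr_eq_self; rewrite {1}(alt3_13 (alt3_psi m)).
    rewrite mulr0 subr0 /kron eqxx mul1r; over.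
  rewrite sumrB -!mulr_sumr sumrB -!mulr_sumr sumr_const card_ord.
  set t := \sum_i T i i => h.
  have: 96 * t = 0 by rewrite -[RHS]h; ring.
  by move/eqP; rewrite mulf_eq0 pnatr_eq0 => /eqP.
move=> l p; have := key l p; rewrite UE tr0 mulr0 => h.
apply: (mulfI (_ : 6 != 0 :> R)); rewrite ?pnatr_eq0 // mulr0 -[RHS]h.
by set s := \sum_i _; ring.
Qed.

Lemma sum_sym_skew n (S A : 'I_n -> 'I_n -> R) :
  (forall i j, S i j = S j i) -> (forall i j, A i j = - A j i) ->
  \sum_i \sum_j S i j * A i j = 0.
Proof.
move=> sS sA; apply: oppr_eq_self; rewrite {1}exchange_big -sumrN.
apply: eq_bigr => i _; rewrite -sumrN; apply: eq_bigr => j _.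
by rewrite sS sA mulrN.
Qed.

Lemma contract2_phi_phi i j : \sum_a \sum_b phi_comp i a b * phi_comp j a b
  = 6 * kron i j.
Proof.
under eq_bigr => a _.
  rewrite contract_phi_phi (_ : psi_comp i a j a = 0) ?addr0; last first.
    by apply: oppr_eq_self; rewrite {1}(alt3_13 (alt3_psi i)).
  rewrite {2}/kron eqxx mulr1; over.
by rewrite sumrB sumr_const card_ord (sum_delta i (fun a => kron a j)); ring.
Qed.

(** Contraction with psi_pijk sends v _| psi to 24 v and kills S.phi, each of whose terms becomes a
    multiple of S_im phi_mpi, symmetric against skew. Once v = 0, contraction of S.phi with phi_jab
    gives 4 S + 2 (tr S) d, whose trace is 18 tr S; hence S = 0. *)
Lemma deriv_phi0_inj (S : 'I_7 -> 'I_7 -> R) (v : 'I_7 -> R) :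
  (forall i j, S i j = S j i) ->
  (forall i j k, deriv_phi0 S i j k + \sum_m v m * psi_comp m i j k = 0) ->
  (forall i j, S i j = 0) /\ (forall m, v m = 0).
Proof.
move=> sS h.
have vP p : \sum_i \sum_j \sum_k (\sum_m v m * psi_comp m i j k) * psi_comp p i j k
  = 24 * v p.
  transitivity (\sum_m v m * (24 * kron m p)); last first.
    rewrite -[in RHS](sum_deltaC p v) mulr_sumr; apply: eq_bigr => m _.
    by rewrite /kron; ring.
  under [RHS]eq_bigr do rewrite -contract3_psi_psi mulr_sumr.
  rewrite [RHS]exchange_big; apply: eq_bigr => i _.
  under [RHS]eq_bigr do rewrite mulr_sumr.
  rewrite [RHS]exchange_big; apply: eq_bigr => j _.
  under [RHS]eq_bigr do rewrite mulr_sumr.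
  rewrite [RHS]exchange_big; apply: eq_bigr => k _.
  by rewrite mulr_suml; apply: eq_bigr => m _; rewrite mulrA.
have SP p : \sum_i \sum_j \sum_k (\sum_m S i m * phi_comp m j k) * psi_comp p i j k = 0.
  transitivity (\sum_i \sum_m S i m * (4 * phi_comp m p i)); last first.
    by apply: sum_sym_skew => // i m; rewrite (alt3_13 alt3_phi) mulrN.
  apply: eq_bigr => i _; under [RHS]eq_bigr do rewrite -contract2_phi_psi mulr_sumr.
  rewrite [RHS]exchange_big; apply: eq_bigr => j _.
  under [RHS]eq_bigr do rewrite mulr_sumr.
  rewrite [RHS]exchange_big; apply: eq_bigr => k _.
  by rewrite mulr_suml; apply: eq_bigr => m _; rewrite mulrA.
have v0 p : v p = 0.
  have: \sum_i \sum_j \sum_k (deriv_phi0 S i j k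
    + \sum_m v m * psi_comp m i j k) * psi_comp p i j k = 0.
    by rewrite big1 // => i _; rewrite big1 // => j _; rewrite big1 // => k _;
      rewrite h mul0r.
  under eq_bigr => i _ do under eq_bigr => j _ do under eq_bigr => k _ do
    rewrite /deriv_phi0 2!big_split /= !mulrDl.
  under eq_bigr => i _ do under eq_bigr => j _ do rewrite !big_split /=.
  under eq_bigr => i _ do rewrite !big_split /=.
  rewrite !big_split /= vP SP.
  have -> : \sum_i \sum_j \sum_k (\sum_m S j m * phi_comp i m k) * psi_comp p i j k = 0.
    rewrite exchange_big -[RHS](SP p); apply: eq_bigr => i _; apply: eq_bigr => j _.
    apply: eq_bigr => k _; rewrite psi_comp_swap23 mulrN -mulNr -sumrN; congr (_ * _).
    by apply: eq_bigr => m _; rewrite phi_comp_swap12 mulrN opprK.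
  have -> : \sum_i \sum_j \sum_k (\sum_m S k m * phi_comp i j m) * psi_comp p i j k = 0.
    under eq_bigr => i _ do rewrite exchange_big.
    rewrite exchange_big -[RHS](SP p); apply: eq_bigr => i _; apply: eq_bigr => j _.
    apply: eq_bigr => k _; rewrite (alt3_cycle (alt3_psi p) i); congr (_ * _).
    by apply: eq_bigr => m _; rewrite (alt3_cycle alt3_phi m).
  by rewrite !add0r => /eqP; rewrite mulf_eq0 pnatr_eq0 => /eqP.
split=> //.
have D0 i j k : deriv_phi0 S i j k = 0.
  by rewrite -[RHS](h i j k) big1 ?addr0 // => m _; rewrite v0 mul0r.
have e i j : 4 * S i j + 2 * (kron i j * \sum_p S p p) = 0.
  have: \sum_a \sum_b deriv_phi0 S i a b * phi_comp j a b = 0.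
    by rewrite big1 // => a _; rewrite big1 // => b _; rewrite D0 mul0r.
  under eq_bigr => a _ do under eq_bigr => b _ do
    rewrite /deriv_phi0 2!big_split /= !mulrDl.
  under eq_bigr => a _ do rewrite !big_split /=.
  rewrite !big_split /=.
  have -> : \sum_a \sum_b (\sum_p S i p * phi_comp p a b) * phi_comp j a b = 6 * S i j.
    transitivity (\sum_p S i p * (6 * kron p j)); last first.
      rewrite -[in RHS](sum_deltaC j (S i)) mulr_sumr; apply: eq_bigr => p _.
      by rewrite /kron; ring.
    under [RHS]eq_bigr do rewrite -contract2_phi_phi mulr_sumr.
    rewrite [RHS]exchange_big; apply: eq_bigr => a _.
    under [RHS]eq_bigr do rewrite mulr_sumr.
    rewrite [RHS]exchange_big; apply: eq_bigr => b _.
    by rewrite mulr_suml; apply: eq_bigr => p _; rewrite mulrA.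
  have e2 : \sum_a \sum_b (\sum_p S a p * phi_comp i p b) * phi_comp j a b =
      kron i j * (\sum_p S p p) - S i j.
    transitivity (\sum_a \sum_p S a p * (kron i j * kron p a - kron i a * kron p j
      + psi_comp i p j a)).
      apply: eq_bigr => a _; under [RHS]eq_bigr do rewrite -contract_phi_phi mulr_sumr.
      rewrite [RHS]exchange_big; apply: eq_bigr => b _.
      by rewrite mulr_suml; apply: eq_bigr => p _; rewrite mulrA.
    under eq_bigr => a _ do under eq_bigr => p _ do rewrite mulrDr mulrBr.
    under eq_bigr => a _ do rewrite big_split sumrB /=.
    rewrite big_split sumrB /= (@sum_sym_skew _ S (fun a p => psi_comp i p j a)) //;
      last first.
      by move=> a p; rewrite (alt3_13 (alt3_psi i)).
    rewrite addr0; congr (_ - _).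
      rewrite mulr_sumr; apply: eq_bigr => a _.
      by rewrite -(sum_deltaC a (S a)) mulr_sumr; apply: eq_bigr => p _; rewrite /kron;
        ring.
    rewrite -(sum_delta i (fun a => S a j)); apply: eq_bigr => a _.
    by rewrite -(sum_deltaC j (S a)) mulr_sumr; apply: eq_bigr => p _; rewrite /kron;
      ring.
  have -> : \sum_a \sum_b (\sum_p S b p * phi_comp i a p) * phi_comp j a b =
      \sum_a \sum_b (\sum_p S a p * phi_comp i p b) * phi_comp j a b.
    rewrite exchange_big; apply: eq_bigr => a _; apply: eq_bigr => b _.
    rewrite phi_comp_swap23 mulrN -mulNr -sumrN; congr (_ * _); apply: eq_bigr => p _.
    by rewrite phi_comp_swap23 mulrN opprK.
  by rewrite e2 => h0; rewrite -[RHS]h0; ring.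
have tr0 : \sum_p S p p = 0.
  have: \sum_i (4 * S i i + 2 * (kron i i * \sum_p S p p)) = 0 by apply: big1 => i _;
    exact: e.
  under eq_bigr do rewrite /kron eqxx mul1r.
  rewrite big_split /= -mulr_sumr sumr_const card_ord.
  set t := \sum_p _ => h0.
  have: 18 * t = 0 by rewrite -[RHS]h0; ring.
  by move/eqP; rewrite mulf_eq0 pnatr_eq0 => /eqP.
move=> i j; have /eqP := e i j; rewrite tr0 !mulr0 addr0 mulf_eq0 pnatr_eq0.
by move/eqP.
Qed.

(** Multiply [contract_phi_psi] by W_ab and sum. Since phi_abm is skew in a, b, only the skew part
    of W enters; for skew W the right-hand side is 2 W.phi. *)
Lemma deriv_phi0_skew (W : 'I_7 -> 'I_7 -> R) i j k :
  \sum_m (\sum_a \sum_b W a b * phi_comp a b m) * psi_comp m i j k =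
    deriv_phi0 W i j k - deriv_phi0 (fun a b => W b a) i j k.
Proof.
transitivity (\sum_a \sum_b W a b * (kron i a * phi_comp b j k - kron i b * phi_comp a j k
  + (kron j a * phi_comp i b k - kron j b * phi_comp i a k)
    + (kron k a * phi_comp i j b - kron k b * phi_comp i j a))).
  under eq_bigr do rewrite mulr_suml.
  rewrite exchange_big; apply: eq_bigr => a _.
  under eq_bigr do rewrite mulr_suml.
  rewrite exchange_big; apply: eq_bigr => b _.
  by rewrite -contract_phi_psi mulr_sumr; apply: eq_bigr => m _; rewrite mulrA.
have e1 (G : 'I_7 -> R) q : \sum_a \sum_b W a b * (kron q a * G b) = \sum_p W q p * G p.
  rewrite -(sum_delta q (fun a => \sum_b W a b * G b)); apply: eq_bigr => a _.
  by rewrite mulr_sumr; apply: eq_bigr => b _; rewrite mulrCA.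
have e2 (G : 'I_7 -> R) q :
    \sum_a \sum_b - (W a b * (kron q b * G a)) = - \sum_p W p q * G p.
  rewrite -sumrN; apply: eq_bigr => a _; rewrite sumrN; congr (- _).
  rewrite -(sum_delta q (fun b => W a b * G a)).
  by apply: eq_bigr => b _; rewrite mulrCA.
under eq_bigr => a _ do under eq_bigr => b _ do rewrite 2!mulrDr !mulrBr.
under eq_bigr => a _ do rewrite !(big_split, sumrB) /=.
rewrite !(big_split, sumrB) /= /deriv_phi0 !big_split /=.
rewrite (e1 (fun p => phi_comp p j k)) (e1 (fun p => phi_comp i p k)) (e1 (fun p =>
  phi_comp i j p)).
rewrite (e2 (fun p => phi_comp p j k)) (e2 (fun p => phi_comp i p k)) (e2 (fun p =>
  phi_comp i j p)).
by ring.
Qed.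

(** [N l] and [Z] stand for nabla_l phi and nabla X, so the vector contracted with psi is d^*(X _|
    phi). Z.phi is the sum of its halves with Z + Z^T and Z - Z^T: the first is the term of L_X g,
    the second is given by [deriv_phi0_skew]. *)
Lemma frame_identity (N : 'I_7 -> 'I_7 -> 'I_7 -> 'I_7 -> R) (X : 'I_7 -> R)
    (Z : 'I_7 -> 'I_7 -> R) :
  (forall l, alt3 (N l)) ->
  (forall l i j k, N l i j k - N i l j k + N j l i k - N k l i j = 0) ->
  (forall l i j, \sum_a \sum_b (N l i a b * phi_comp j a b + phi_comp i a b * N l j a b)
    = 0) ->
  forall i j k, \sum_l X l * N l i j k + deriv_phi0 Z i j k =
    2^-1 * deriv_phi0 (fun a b => Z a b + Z b a) i j k
    + 2^-1 * \sum_m (- \sum_a (\sum_l Z a l * phi_comp l a m + \sum_l X l * N a l a m))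
       * psi_comp m i j k.
Proof.
move=> altN clN metN i j k.
pose T l m : R := 24^-1 * \sum_a \sum_b \sum_d N l a b d * psi_comp m a b d.
have NT l a b d : N l a b d = \sum_m T l m * psi_comp m a b d.
  exact: (alt3_in_Lambda7 (altN l) (metN l)).
have T14 l p : - (\sum_a \sum_m T a m * psi_comp m l a p) = 2 * T l p.
  apply/eqP; rewrite eq_sym -addr_eq0; apply/eqP; apply: torsion_in14 => {p}l a b d.
  by rewrite -!NT.
under [X in _ = _ + 2^-1 * X]eq_bigr => m _.
  rewrite big_split /= opprD mulrDl.
  rewrite [X in - X * _ + _](_ : _ = - \sum_a \sum_b Z a b * phi_comp a b m); last first.
    rewrite -sumrN; apply: eq_bigr => a _; rewrite -sumrN; apply: eq_bigr => b _.
    by rewrite phi_comp_swap12 mulrN.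
  (* The divergence of phi: nabla_a phi_lam = T_aq psi_qlam = -2 T_lm by [T14]. *)
  rewrite opprK [X in _ + (- X) * _](_ : _ = - (2 * \sum_l X l * T l m)); last first.
    rewrite exchange_big mulr_sumr -sumrN; apply: eq_bigr => l _.
    transitivity (X l * \sum_a \sum_q T a q * psi_comp q l a m).
      by rewrite mulr_sumr; apply: eq_bigr => a _; rewrite NT.
    by rewrite -[\sum_a _]opprK T14; ring.
  rewrite opprK; over.
rewrite big_split /= deriv_phi0_skew.
have -> : \sum_l X l * N l i j k
  = 2^-1 * \sum_m (2 * \sum_l X l * T l m) * psi_comp m i j k.
  under [in RHS]eq_bigr do rewrite -mulrA mulr_suml.
  rewrite -mulr_sumr exchange_big mulrA mulVf ?pnatr_eq0 // mul1r.
  apply: eq_bigr => l _; rewrite NT mulr_sumr.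
  by apply: eq_bigr => m _; rewrite mulrA.
have -> : deriv_phi0 (fun a b => Z a b + Z b a) i j k = deriv_phi0 Z i j k
  + deriv_phi0 (fun a b => Z b a) i j k.
  by rewrite /deriv_phi0 -big_split; apply: eq_bigr => p _ /=; ring.
by field.
Qed.

End Contractions.

(** * Linear change of frame *)

Section Pull.
Context {R : realType} {n : nat}.

(** One matrix per slot: the derivation action is a sum of such pullbacks, with Z in one slot and
    the identity in the others ([act_mpull]), and thereby composes with ordinary pullbacks through
    [mpull_comp]. *)
Definition mpull k (A : 'I_k -> 'M[R]_n) (T : tensor R n k) : tensor R n k :=
  fun I => \sum_(J : k.-tuple 'I_n) (\prod_(r < k) A r (tnth I r) (tnth J r)) * T J.

(* The derivation action of an endomorphism on covariant tensors. *)
Definition act k (Z : 'M[R]_n) (T : tensor R n k) : tensor R n k :=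
  fun I => \sum_(r < k) \sum_(p < n) Z (tnth I r) p *
    T [tuple if s == r then p else tnth I s | s < k].

Lemma mktuple_bij k : bijective (fun f : {ffun 'I_k -> 'I_n} => [tuple f r | r < k]).
Proof.
exists (fun J : k.-tuple 'I_n => [ffun r => tnth J r]).
  by move=> f; apply/ffunP => r; rewrite ffunE tnth_mktuple.
by move=> J; apply: eq_from_tnth => r; rewrite tnth_mktuple ffunE.
Qed.

Lemma prod_sum_tuple k (F : 'I_k -> 'I_n -> R) :
  \prod_(r < k) \sum_(j < n) F r j =
  \sum_(J : k.-tuple 'I_n) \prod_(r < k) F r (tnth J r).
Proof.
rewrite bigA_distr_bigA (reindex _ (onW_bij _ (mktuple_bij k))) /=.
by apply: eq_bigr => f _; apply: eq_bigr => r _; rewrite tnth_mktuple.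
Qed.

Lemma eq_mpull k (A B : 'I_k -> 'M[R]_n) (S T : tensor R n k) :
  (forall r, A r = B r) -> S =1 T -> mpull A S =1 mpull B T.
Proof.
move=> AB ST I; apply: eq_bigr => J _; rewrite ST; congr (_ * _).
by apply: eq_bigr => r _; rewrite AB.
Qed.

Lemma eq_pullback k (A : 'M[R]_n) (S T : tensor R n k) :
  S =1 T -> pullback A S =1 pullback A T.
Proof. exact: eq_mpull. Qed.

Lemma mpull_comp k (A B : 'I_k -> 'M[R]_n) (T : tensor R n k) :
  mpull A (mpull B T) =1 mpull (fun r => A r *m B r) T.
Proof.
move=> I; rewrite /mpull; under eq_bigr do rewrite mulr_sumr.
rewrite exchange_big; apply: eq_bigr => J _ /=.
under eq_bigr do rewrite mulrA; rewrite -mulr_suml; congr (_ * _).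
under [RHS]eq_bigr do rewrite mxE.
rewrite prod_sum_tuple; apply: eq_bigr => K _.
by rewrite big_split.
Qed.

Lemma pullback_comp k (A B : 'M[R]_n) (T : tensor R n k) :
  pullback A (pullback B T) =1 pullback (A *m B) T.
Proof. exact: mpull_comp. Qed.

Lemma tuple_delta k (I : k.-tuple 'I_n) (G : k.-tuple 'I_n -> R) :
  \sum_J (\prod_(r < k) (tnth I r == tnth J r)%:R) * G J = G I.
Proof.
rewrite (bigD1 I) //= big1 ?mul1r => [|r _]; last by rewrite eqxx.
rewrite big1 ?addr0 // => J /negP JI.
have [r Ir] : exists r, tnth I r != tnth J r.
  apply/existsP; rewrite -negb_forall; apply/negP => /forallP h; apply: JI.
  by apply/eqP/eq_from_tnth => r; apply/esym/eqP.
by rewrite (bigD1 r) //= (negbTE Ir) !mul0r.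
Qed.

Lemma pullback1 k (T : tensor R n k) : pullback 1%:M T =1 T.
Proof.
move=> I; rewrite -[RHS]tuple_delta; apply: eq_bigr => J _; congr (_ * _).
by apply: eq_bigr => r _; rewrite mxE.
Qed.

Lemma pullbackK k (u : 'M[R]_n) (T : tensor R n k) : u \in unitmx ->
  pullback u (pullback (invmx u) T) =1 T.
Proof.
move=> uu I; rewrite pullback_comp mulmxV //; exact: pullback1.
Qed.

Lemma pullbackVK k (u : 'M[R]_n) (T : tensor R n k) : u \in unitmx ->
  pullback (invmx u) (pullback u T) =1 T.
Proof.
move=> uu I; rewrite pullback_comp mulVmx //; exact: pullback1.
Qed.

Lemma pullback_sum k (I : finType) (u : 'M[R]_n) (c : I -> R) (T : I -> tensor R n k) :
  pullback u (fun K => \sum_i c i * T i K) =1 fun K => \sum_i c i * pullback u (T i) K.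
Proof.
move=> K; rewrite /pullback; under eq_bigr do rewrite mulr_sumr.
rewrite exchange_big; apply: eq_bigr => i _; rewrite mulr_sumr.
by apply: eq_bigr => J _; rewrite mulrCA.
Qed.

Lemma pullbackZ k (u : 'M[R]_n) c (T : tensor R n k) :
  pullback u (fun K => c * T K) =1 fun K => c * pullback u T K.
Proof.
by move=> K; rewrite /pullback mulr_sumr; apply: eq_bigr => J _; rewrite mulrCA.
Qed.

Lemma pullbackD k (u : 'M[R]_n) (S T : tensor R n k) :
  pullback u (fun K => S K + T K) =1 fun K => pullback u S K + pullback u T K.
Proof.
by move=> K; rewrite /pullback -big_split; apply: eq_bigr => J _; rewrite mulrDr.
Qed.

Lemma act_mpull k (Z : 'M[R]_n) (T : tensor R n k) I :
  act Z T I = \sum_(r < k) mpull (fun s => if s == r then Z else 1%:M) T I.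
Proof.
apply: eq_bigr => r _; rewrite /mpull.
rewrite (partition_big (fun J : k.-tuple 'I_n => tnth J r) xpredT) //=.
apply: eq_bigr => p _.
set J0 := [tuple _ | _ < k].
rewrite (bigD1 J0) /=; last by rewrite tnth_mktuple eqxx.
rewrite (bigD1 r) //= eqxx tnth_mktuple eqxx big1 => [|s /negbTE sr]; last first.
  by rewrite tnth_mktuple sr mxE eqxx.
rewrite mulr1 big1 ?addr0 // => J /andP[/eqP Jr JJ0].
have [s Js] : exists s, tnth J s != tnth J0 s.
  apply/existsP; rewrite -negb_forall; apply: contra JJ0 => /forallP h.
  by apply/eqP/eq_from_tnth => s; apply/eqP.
rewrite (bigD1 s) //=; move: Js; rewrite tnth_mktuple.
case: (eqVneq s r) => [->|sr]; first by rewrite Jr eqxx.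
by rewrite mxE eq_sym => /negbTE ->; rewrite !mul0r.
Qed.

Lemma mpull_sum k (I : finType) (A : 'I_k -> 'M[R]_n) (T : I -> tensor R n k) :
  mpull A (fun K => \sum_i T i K) =1 fun K => \sum_i mpull A (T i) K.
Proof.
move=> K; rewrite /mpull; under eq_bigr do rewrite mulr_sumr.
by rewrite exchange_big.
Qed.

(** The hypothesis says that Z and Z' are the same endomorphism in two frames; in each slot the
    matrix moves past u. *)
Lemma act_pullback k (Z Z' u : 'M[R]_n) (T : tensor R n k) : Z *m u = u *m Z' ->
  act Z (pullback u T) =1 pullback u (act Z' T).
Proof.
move=> Zu I; rewrite act_mpull.
rewrite (eq_pullback u (act_mpull Z' T) I).
rewrite [RHS]mpull_sum; apply: eq_bigr => r _.
rewrite !mpull_comp; apply: eq_mpull => // s.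
by case: ifP => _; rewrite ?Zu ?mulmx1 ?mul1mx.
Qed.

Lemma eq_act k (Z : 'M[R]_n) (S T : tensor R n k) : S =1 T -> act Z S =1 act Z T.
Proof. by move=> h I; apply: eq_bigr => r _; apply: eq_bigr => p _; rewrite h. Qed.

Lemma sum_tupleS k (G : k.+1.-tuple 'I_n -> R) :
  \sum_J G J = \sum_i \sum_(J : k.-tuple 'I_n) G [tuple of i :: J].
Proof.
rewrite pair_bigA /= (reindex (fun p : 'I_n * k.-tuple 'I_n =>
  [tuple of p.1 :: p.2])) //=.
exists (fun J : k.+1.-tuple 'I_n => (thead J, [tuple of behead J])).
  by case=> i J _ /=; congr pair; apply: val_inj.
by move=> J _ /=; rewrite [RHS]tuple_eta.
Qed.

Lemma iprod_pullback k (v : 'rV[R]_n) (u : 'M[R]_n) (T : tensor R n k.+1) :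
  iprod v (pullback u T) =1 pullback u (iprod (v *m u) T).
Proof.
move=> I; rewrite /iprod /pullback.
transitivity (\sum_l v 0 l * \sum_i \sum_(J : k.-tuple 'I_n)
   u l i * (\prod_(r < k) u (tnth I r) (tnth J r)) * T [tuple of i :: J]).
  apply: eq_bigr => l _; congr (_ * _); rewrite sum_tupleS.
  apply: eq_bigr => i _; apply: eq_bigr => J _; rewrite big_ord_recl; congr (_ * _ * _).
  by apply: eq_bigr => r _; rewrite !tnthS.
transitivity (\sum_i (v *m u) 0 i * \sum_(J : k.-tuple 'I_n)
   (\prod_(r < k) u (tnth I r) (tnth J r)) * T [tuple of i :: J]).
  under [RHS]eq_bigr do rewrite mxE mulr_suml.
  rewrite [RHS]exchange_big; apply: eq_bigr => l _; rewrite mulr_sumr.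
  apply: eq_bigr => i _; rewrite !mulr_sumr; apply: eq_bigr => J _.
  by rewrite !mulrA.
under [RHS]eq_bigr do rewrite mulr_sumr.
rewrite [RHS]exchange_big; apply: eq_bigr => i _; rewrite mulr_sumr.
by apply: eq_bigr => J _; rewrite mulrCA.
Qed.

Lemma sum_tuple_cat k m (G : (k + m).-tuple 'I_n -> R) :
  \sum_J G J = \sum_(K : k.-tuple 'I_n) \sum_(L : m.-tuple 'I_n) G [tuple of K ++ L].
Proof.
rewrite pair_bigA /= (reindex (fun p : k.-tuple 'I_n * m.-tuple 'I_n =>
  [tuple of p.1 ++ p.2])) //=.
exists (fun J : (k + m).-tuple 'I_n =>
  ([tuple tnth J (lshift m r) | r < k], [tuple tnth J (rshift k r) | r < m])).
  case=> K L _ /=; congr pair; apply: eq_from_tnth => r; rewrite tnth_mktuple.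
    by rewrite tnth_lshift.
  by rewrite tnth_rshift.
move=> J _ /=; apply: eq_from_tnth => r; case: (split_ordP r) => s ->.
  by rewrite tnth_lshift tnth_mktuple.
by rewrite tnth_rshift tnth_mktuple.
Qed.

Lemma sum_pullback k (u : 'M[R]_n) (S T : tensor R n k) :
  \sum_I pullback u S I * T I = \sum_I S I * pullback u^T T I.
Proof.
rewrite /pullback; under eq_bigr do rewrite mulr_suml.
rewrite exchange_big; apply: eq_bigr => J _; rewrite mulr_sumr.
apply: eq_bigr => I _; rewrite -mulrA mulrCA; congr (_ * (_ * _)).
by apply: eq_bigr => r _; rewrite mxE.
Qed.

Lemma pullback_cat k m (u : 'M[R]_n) (T : tensor R n (k + m))
    (I : k.-tuple 'I_n) (J : m.-tuple 'I_n) :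
  pullback u T [tuple of I ++ J] =
  pullback u (fun K => pullback u (fun L => T [tuple of K ++ L]) J) I.
Proof.
rewrite {1}/pullback sum_tuple_cat; apply: eq_bigr => K _; rewrite mulr_sumr.
apply: eq_bigr => L _; rewrite big_split_ord /= mulrA; congr (_ * _ * _).
  by apply: eq_bigr => r _; rewrite !tnth_lshift.
by apply: eq_bigr => r _; rewrite !tnth_rshift.
Qed.

Lemma perm_cat_tuple k m (I J : (k + m).-tuple 'I_n) (s : 'S_(k + m)) (u : 'M[R]_n) :
  (\prod_(r < k) u (tnth I (s (lshift m r))) (tnth J (lshift m r))) *
  (\prod_(r < m) u (tnth I (s (rshift k r))) (tnth J (rshift k r))) =
  \prod_(r < k + m) u (tnth I r) (tnth J (s^-1%g r)).
Proof.
rewrite -(big_split_ord _ xpredT (fun r => u (tnth I (s r)) (tnth J r))) /=.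
rewrite [RHS](reindex_inj (@perm_inj _ s)) /=.
by apply: eq_bigr => r _; rewrite permK.
Qed.

Lemma permute_tuple_bij k (s : 'S_k) :
  bijective (fun J : k.-tuple 'I_n => [tuple tnth J (s r) | r < k]).
Proof.
exists (fun J : k.-tuple 'I_n => [tuple tnth J (s^-1%g r) | r < k]) => J;
  by apply: eq_from_tnth => r; rewrite !tnth_mktuple ?permK ?permKV.
Qed.

Lemma wedge_pullback k m (u : 'M[R]_n) (a : tensor R n k) (b : tensor R n m) :
  wedge (pullback u a) (pullback u b) =1 pullback u (wedge a b).
Proof.
move=> I; rewrite /wedge pullbackZ; congr (_ * _).
transitivity (\sum_(s : 'S_(k + m)) (-1) ^+ s *
    pullback u (fun I => a [tuple tnth I (s (lshift m r)) | r < k] *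
                      b [tuple tnth I (s (rshift k r)) | r < m]) I); last first.
  rewrite -(@pullback_sum (k + m) 'S_(k + m) u _ (fun s I =>
    a [tuple tnth I (s (lshift m r)) | r < k] *
                      b [tuple tnth I (s (rshift k r)) | r < m]) I).
  by apply: eq_pullback => J; apply: eq_bigr => s _; rewrite mulrA.
apply: eq_bigr => s _; rewrite -mulrA; congr (_ * _).
rewrite [RHS](reindex _ (onW_bij _ (permute_tuple_bij (s^-1%g)))) /=.
rewrite [RHS]sum_tuple_cat mulr_suml; apply: eq_bigr => K _.
rewrite mulr_sumr; apply: eq_bigr => L _.
rewrite mulrACA; congr (_ * _).
  under [RHS]eq_bigr do rewrite tnth_mktuple.
  rewrite -(perm_cat_tuple I [tuple of K ++ L] s).
  congr (_ * _); apply: eq_bigr => r _; rewrite !tnth_mktuple.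
    by rewrite tnth_lshift.
  by rewrite tnth_rshift.
congr (a _ * b _); apply: eq_from_tnth => r; rewrite !tnth_mktuple permK.
  by rewrite tnth_lshift.
by rewrite tnth_rshift.
Qed.

Lemma alternating_wedge k m (a : tensor R n k) (b : tensor R n m) :
  alternating (wedge a b).
Proof.
move=> s I; rewrite /wedge mulrCA; congr (_ * _).
rewrite [RHS]mulr_sumr [RHS](reindex_inj (mulIg s)) /=.
apply: eq_bigr => t _; rewrite odd_permM signr_addb !mulrA.
rewrite [(-1) ^+ s * _]mulrC -[_ * _ * (-1) ^+ s]mulrA -signr_addb addbb mulr1.
by congr (_ * a _ * b _); apply: eq_from_tnth => r; rewrite !tnth_mktuple permM.
Qed.

Lemma alternating_pullback k (u : 'M[R]_n) (T : tensor R n k) :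
  alternating T -> alternating (pullback u T).
Proof.
move=> aT s I; rewrite mulr_sumr.
rewrite [LHS](reindex _ (onW_bij _ (permute_tuple_bij s))) /=.
apply: eq_bigr => J _; rewrite aT mulrCA; congr (_ * (_ * _)).
rewrite [RHS](reindex_inj (@perm_inj _ s)) /=.
by apply: eq_bigr => r _; rewrite !tnth_mktuple.
Qed.

Lemma alternatingZ k c (T : tensor R n k) :
  alternating T -> alternating (fun I => c * T I).
Proof. by move=> aT s I; rewrite aT mulrCA. Qed.

Lemma alternating_eq0 k (T : tensor R n k) (I : k.-tuple 'I_n) i j :
  alternating T -> i != j -> tnth I i = tnth I j -> T I = 0.
Proof.
move=> aT ij Iij; apply: oppr_eq_self; rewrite -mulN1r.
have {1}-> : I = [tuple tnth I (tperm i j r) | r < k].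
  apply: eq_from_tnth => r; rewrite tnth_mktuple.
  by case: tpermP => [->|->|].
by rewrite aT odd_tperm ij expr1.
Qed.

(** Forms of top degree span a line: an injective multi-index is a permutation of the basic one, and
    on a repeated index both sides vanish. *)
Lemma alternating_top_eq (S T : tensor R n n) : alternating S -> alternating T ->
  S (ord_tuple n) = T (ord_tuple n) -> S =1 T.
Proof.
move=> aS aT e I; case: (boolP (injectiveb (tnth I))) => [/injectiveP inj|].
  have -> : I = [tuple tnth (ord_tuple n) (perm inj r) | r < n].
    by apply: eq_from_tnth => r; rewrite tnth_mktuple tnth_ord_tuple permE.
  by rewrite aS aT e.
case/injectivePn => i [j ij Iij].
by rewrite (alternating_eq0 aS _ Iij) ?(alternating_eq0 aT _ Iij) // eq_sym.
Qed.

Lemma alternating_dx k (J : k.-tuple 'I_n) : alternating (dx (R := R) J).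
Proof.
move=> s I; rewrite /dx.
transitivity (\det (col_perm s (\matrix_(r < k, t < k) (tnth J r == tnth I t)%:R :
  'M[R]_k))).
  by congr (\det _); apply/matrixP => i j; rewrite !mxE tnth_mktuple.
by rewrite col_permE det_mulmx det_perm odd_permV mulrC.
Qed.

Lemma dx_id : dx (R := R) (ord_tuple n) (ord_tuple n) = 1.
Proof.
rewrite /dx -[RHS](det1 R n); congr (\det _).
by apply/matrixP => i j; rewrite !mxE !tnth_ord_tuple.
Qed.

Lemma pullback_dx_id (u : 'M[R]_n) :
  pullback u (dx (ord_tuple n)) (ord_tuple n) = \det u.
Proof.
rewrite /pullback /dx; under eq_bigr do rewrite mulr_sumr.
rewrite exchange_big /= [RHS](reindex_inj (inj_comp (@invg_inj _) (@inj_id _))) /=.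
apply: eq_bigr => s _; rewrite odd_permV.
transitivity ((-1) ^+ s * \sum_(J : n.-tuple 'I_n)
   (\prod_(r < n) (tnth [tuple (s^-1)%g r | r < n] r == tnth J r)%:R)
    * \prod_r u r (tnth J r)).
  rewrite mulr_sumr; apply: eq_bigr => J _; rewrite mulrCA; congr (_ * _).
  rewrite mulrC; congr (_ * _); last first.
    by apply: eq_bigr => r _; rewrite tnth_ord_tuple.
  rewrite [RHS](reindex_inj (@perm_inj _ s)) /=.
  by apply: eq_bigr => r _; rewrite !mxE tnth_ord_tuple tnth_mktuple permK.
rewrite tuple_delta; congr (_ * _).
by apply: eq_bigr => r _; rewrite tnth_mktuple.
Qed.

End Pull.

(** * Components of phi0 and psi0 *)

Lemma sum_intE (R : pzRingType) (F : nat -> int) n :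
  (sum_int F n)%:~R = \sum_(s < n) (F s)%:~R :> R.
Proof.
rewrite -(big_mkord xpredT (fun s => (F s)%:~R)) /index_iota subn0 /sum_int.
elim: (iota 0 n) => [|s l IH]; first by rewrite big_nil.
by rewrite big_cons /= intrD IH.
Qed.

Lemma sign_intE (R : pzRingType) s : (sign_int s)%:~R = (-1) ^+ s :> R.
Proof. by rewrite -signr_odd /sign_int; case: (odd s). Qed.

Lemma size_remove_at (T : Type) n s (I : seq T) :
  (s < n.+1)%N -> size I = n.+1 -> size (remove_at s I) = n.
Proof.
by move=> sn sI; rewrite size_cat size_takel ?size_drop sI 1?ltnW // subSS subnKC.
Qed.

Lemma nth_remove_at (T : Type) (x0 : T) n s (I : seq T) k :
  (s < n.+1)%N -> size I = n.+1 -> nth x0 (remove_at s I) k = nth x0 I (bump s k).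
Proof.
move=> sn sI; have se : size (take s I) = s by rewrite size_takel ?sI ?(ltnW sn).
rewrite nth_cat se /bump.
case: (ltnP k s) => sk; first by rewrite nth_take.
by rewrite nth_drop addSn subnKC.
Qed.

Lemma det_seqE (R : comNzRingType) n (J I : seq nat) : size J = n -> size I = n ->
  \det (\matrix_(r < n, s < n) (nth 0%N J r == nth 0%N I s)%:R : 'M[R]_n) =
  (det_seq J I)%:~R.
Proof.
elim: n J I => [|n IH] J I; first by move/size0nil => -> _; rewrite det_mx00.
case: J => // x J [sJ] sI; rewrite (expand_det_row _ ord0) /= sum_intE sI.
apply: eq_bigr => s _; rewrite mxE /= eq_sym.
case: eqP => _; rewrite ?mul1r ?mul0r //.
rewrite intrM sign_intE /cofactor add0n -IH ?(size_remove_at (ltn_ord s) sI) //.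
congr (_ * \det _); apply/matrixP => i j.
by rewrite !mxE (nth_remove_at _ _ (ltn_ord s) sI).
Qed.

Lemma dx_seq (R : realType) n k (J I : k.-tuple 'I_n) :
  dx (R := R) J I = (det_seq (map val J) (map val I))%:~R.
Proof.
rewrite -(@det_seqE R k) ?size_map ?size_tuple //; congr (\det _).
apply/matrixP => r s; rewrite !mxE.
have e (K : k.-tuple 'I_n) (t : 'I_k) : nth 0%N (map val K) t = tnth K t.
  by rewrite (nth_map (tnth K t)) ?size_tuple // -tnth_nth.
by rewrite !e.
Qed.

(** Signed sum over the orderings of [I], produced by choosing the first entry and recursing on the
    rest; it is the computable replacement for a sum over ['S_n]. *)
Fixpoint alt_sum (n : nat) (G : seq nat -> int) (I : seq nat) : int :=
  if n is m.+1 then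
    sum_int (fun j => sign_int j * alt_sum m (fun t =>
      G (nth 0%N I j :: t)) (remove_at j I)) n
  else G [::].

(** Permutations are grouped by the image j of 0. Those with a given j are the [lift_perm ord0 j s],
    of sign (-1)^j times the sign of s; they list the j-th entry and then a rearrangement of the
    others. *)
Lemma sum_perm_rec (T : Type) (x0 : T) (R : pzRingType) n (G : seq T -> R) (I : seq T) :
  size I = n.+1 ->
  \sum_(s : 'S_n.+1) (-1) ^+ s * G [seq nth x0 I (s r) | r <- enum 'I_n.+1] =
  \sum_(j < n.+1) (-1) ^+ j * \sum_(s : 'S_n) (-1) ^+ s *
    G (nth x0 I j :: [seq nth x0 (remove_at j I) (s r) | r <- enum 'I_n]).
Proof.
move=> sI; rewrite (partition_big (fun s : 'S_n.+1 => s ord0) xpredT) //=.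
apply: eq_bigr => j _; rewrite mulr_sumr.
have inj : injective (lift_perm ord0 j).
  move=> s t st; apply/permP => k; apply: (@lift_inj _ j).
  by rewrite -!(lift_perm_lift ord0) st.
rewrite (eq_bigl (mem (lift_perm ord0 j @: [set: 'S_n]))) => [|s]; last first.
  apply/eqP/imsetP => [s0|[t _ ->]]; last by rewrite lift_perm_id.
  (* A permutation sending 0 to j maps the complement of 0 onto the complement of j; [f] is this map
     with both complements renumbered. *)
  have /fin_all_exists[f fP] k : exists l, s (lift ord0 k) = lift j l.
    have : j != s (lift ord0 k) by rewrite -s0 (inj_eq perm_inj) neq_lift.
    by case/unlift_some => l -> _; exists l.
  have finj : injective f.
    by move=> k l e; apply: (@lift_inj _ ord0); apply: (@perm_inj _ s); rewrite !fP e.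
  exists (perm finj) => //; apply/permP => k.
  case: (unliftP ord0 k) => [l|] ->; first by rewrite lift_perm_lift permE fP.
  by rewrite lift_perm_id.
rewrite big_imset /=; last by move=> s t _ _; exact: inj.
rewrite big_set /=; apply: eq_bigr => s _.
rewrite odd_lift_perm /= signr_addb signr_odd mulrA; congr (_ * G _).
rewrite enum_ordSl /= lift_perm_id -map_comp; congr (_ :: _).
by apply: eq_map => k /=; rewrite lift_perm_lift (nth_remove_at _ _ (ltn_ord j) sI).
Qed.

Lemma sum_perm0 (R : pzRingType) (F : 'S_0 -> R) : \sum_(s : 'S_0) (-1) ^+ s * F s
  = F 1%g.
Proof.
rewrite (big_pred1 (1%g : 'S_0)) => [|s]; last first.
  by rewrite /= (_ : s = 1%g) ?eqxx //; apply/permP => -[].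
by rewrite odd_perm1 expr0 mul1r.
Qed.

Lemma alt_sumE (R : realType) n (G : seq nat -> int) (I : seq nat) : size I = n ->
  \sum_(s : 'S_n) (-1) ^+ s * (G [seq nth 0%N I (s r) | r <- enum 'I_n])%:~R =
  (alt_sum n G I)%:~R :> R.
Proof.
elim: n G I => [|n IH] G I sI; first by rewrite sum_perm0 enum_ord0.
rewrite (@sum_perm_rec _ 0%N _ _ (fun l => (G l)%:~R)) // -/(sum_int _ n.+1) sum_intE.
apply: eq_bigr => j _.
by rewrite intrM sign_intE -(IH _ _ (size_remove_at (ltn_ord j) sI)).
Qed.

Lemma map_enum_split (T : Type) k m (F : 'I_(k + m) -> T) :
  [seq F r | r <- enum 'I_(k + m)] =
  [seq F (lshift m r) | r <- enum 'I_k] ++ [seq F (rshift k r) | r <- enum 'I_m].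
Proof.
suff /(congr1 val) : [tuple F r | r < k + m] =
  [tuple of [tuple F (lshift m r) | r < k] ++ [tuple F (rshift k r) | r < m]] by [].
apply: eq_from_tnth => r; rewrite tnth_mktuple; case: (split_ordP r) => s ->.
  by rewrite tnth_lshift tnth_mktuple.
by rewrite tnth_rshift tnth_mktuple.
Qed.

Lemma wedge_seq (R : realType) n k m (a : tensor R n k) (b : tensor R n m)
    (af bf : seq nat -> int) :
  (forall K, a K = (af (map val K))%:~R) -> (forall K, b K = (bf (map val K))%:~R) ->
  forall I : (k + m).-tuple 'I_n, wedge a b I = (k`! * m`!)%:R^-1 *
    (alt_sum (k + m) (fun l => af (take k l) * bf (drop k l)) (map val I))%:~R.
Proof.
have sz j U (f : 'I_j -> U) : size [seq f r | r <- enum 'I_j] = j.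
  by rewrite size_map size_enum_ord.
move=> ha hb I; rewrite /wedge -alt_sumE ?size_map ?size_tuple //; congr (_ * _).
apply: eq_bigr => s _; rewrite -mulrA intrM ha hb; congr (_ * (_ * _)).
  congr (af _)%:~R; rewrite map_enum_split (take_size_cat _ (sz _ _ _)).
  rewrite -map_comp; apply: eq_map => r /=.
  by rewrite (nth_map (tnth I (s (lshift m r)))) ?size_tuple // -tnth_nth.
congr (bf _)%:~R; rewrite map_enum_split (drop_size_cat _ (sz _ _ _)).
rewrite -map_comp; apply: eq_map => r /=.
by rewrite (nth_map (tnth I (s (rshift k r)))) ?size_tuple // -tnth_nth.
Qed.

Lemma wedgeZl (R : realType) n k m c (a : tensor R n k) (b : tensor R n m) :
  wedge (fun I => c * a I) b =1 fun I => c * wedge a b I.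
Proof.
move=> I; rewrite /wedge mulrCA; congr (_ * _); rewrite mulr_sumr.
by apply: eq_bigr => s _; rewrite (mulrCA _ c) -(mulrA c).
Qed.

Lemma eq_wedge (R : realType) n k m (a a' : tensor R n k) (b b' : tensor R n m) :
  a =1 a' -> b =1 b' -> wedge a b =1 wedge a' b'.
Proof.
by move=> ha hb I; congr (_ * _); apply: eq_bigr => s _; rewrite ha hb.
Qed.

Definition seq3 (f : nat -> nat -> nat -> int) (l : seq nat) : int :=
  f (nth 0%N l 0) (nth 0%N l 1) (nth 0%N l 2).

Lemma e3E (R : realType) (a b c : nat) (i j k : 'I_7) :
  (0 < a <= 7)%N -> (0 < b <= 7)%N -> (0 < c <= 7)%N ->
  e3 R a b c [tuple i; j; k] =
  (det_seq [:: a.-1; b.-1; c.-1] [:: val i; val j; val k])%:~R.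
Proof.
have lt7 d : (0 < d <= 7)%N -> (d.-1 < 7)%N by case: d.
by move=> /lt7 a7 /lt7 b7 /lt7 c7; rewrite /e3 dx_seq /= !inordK.
Qed.

Lemma phi0E (R : realType) (i j k : 'I_7) : phi0 R [tuple i; j; k] = phi_comp R i j k.
Proof.
rewrite /phi0 !e3E // /phi_comp phi_coefE /phi_int; cbv zeta beta.
by move: det_seq => D; rewrite !(intrD, intrN).
Qed.

Lemma phi0_seq (R : realType) (I : 3.-tuple 'I_7) :
  phi0 R I = (seq3 phi_coef (map val I))%:~R.
Proof.
case/tupleP: I => i I; case/tupleP: I => j I; case/tupleP: I => k I.
rewrite (tuple0 I) -[RHS](phi0E R i j k); congr (phi0 _ _); exact: val_inj.
Qed.

Lemma iprod_phi0_seq (R : realType) (p : 'I_7) (K : 2.-tuple 'I_7) :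
  iprod (delta_mx 0 p) (phi0 R) K =
  (phi_coef p (nth 0%N (map val K) 0) (nth 0%N (map val K) 1))%:~R.
Proof.
rewrite /iprod -[RHS](sum_deltaC p (fun l => (phi_coef l _ _)%:~R)).
apply: eq_bigr => l _; rewrite mxE eqxx /= phi0_seq; congr (_ * _).
Qed.

(** The normalizing factors of the two wedge products are left out, to stay within the integers. The
    test on [c] skips the inner sum whenever the last three slots miss every term of phi0, which
    keeps the sum over 7! orderings cheap. *)
Definition triple_wedge (p q : nat) : int :=
  alt_sum 7 (fun l => let c := seq3 phi_coef (drop 4 l) in
    if c == 0 then 0 else
    alt_sum 4 (fun l => phi_coef p (nth 0%N (take 2 l) 0) (nth 0%N (take 2 l) 1) *
      phi_coef q (nth 0%N (drop 2 l) 0) (nth 0%N (drop 2 l) 1)) (take 4 l) * c)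
        (iota 0 7).
Definition hodge_phi0 (a b c d : nat) : int :=
  sum7 (fun i => sum7 (fun j => sum7 (fun k => let x := phi_coef i j k in
    if x == 0 then 0 else x * det_seq (iota 0 7) [:: i; j; k; a; b; c; d]))).

Lemma triple_wedge_phi0 (R : realType) (p q : 'I_7) :
  wedge (wedge (iprod (delta_mx 0 p) (phi0 R)) (iprod (delta_mx 0 q) (phi0 R)))
    (phi0 R) (ord_tuple 7) = 6 * (p == q)%:R.
Proof.
pose G2 l := phi_coef p (nth 0%N (take 2 l) 0) (nth 0%N (take 2 l) 1) *
  phi_coef q (nth 0%N (drop 2 l) 0) (nth 0%N (drop 2 l) 1).
have h2 : wedge (iprod (delta_mx 0 p) (phi0 R)) (iprod (delta_mx 0 q) (phi0 R)) =1
    fun I => (2`! * 2`!)%:R^-1 * (alt_sum 4 G2 (map val I))%:~R.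
  move=> I; apply: (@wedge_seq R 7 2 2 _ _
    (fun l => phi_coef p (nth 0%N l 0) (nth 0%N l 1))
    (fun l => phi_coef q (nth 0%N l 0) (nth 0%N l 1))) => K; exact: iprod_phi0_seq.
rewrite (eq_wedge h2 (fun=> erefl)) wedgeZl.
rewrite (@wedge_seq R 7 4 3 _ _ (fun l => alt_sum 4 G2 l) (seq3 phi_coef)) //; last first.
  exact: phi0_seq.
have -> : (fun l => alt_sum 4 G2 (take 4 l) * seq3 phi_coef (drop 4 l)) =
    (fun l => let c := seq3 phi_coef (drop 4 l) in
       if c == 0 then 0 else alt_sum 4 G2 (take 4 l) * c).
  by apply: boolp.funext => l; cbv zeta; case: eqP => [->|_]; rewrite ?mulr0.
rewrite [map _ (ord_tuple 7)](val_enum_ord 7).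
rewrite -[alt_sum (4 + 3) _ _]/(triple_wedge p q).
(* 3456 = 6 * (2! 2!) * (4! 3!), the last two factors being the omitted normalizations. *)
have /eqP -> : triple_wedge p q == 3456 * kron_int p q.
  by refine (@all7_2 (fun p q => triple_wedge p q == 3456 * kron_int p q) _ p q);
    vm_compute.
rewrite intrM -kronE /kron -pmulrn.
have -> : (2`! * 2`!)%N = 4%N by [].
have -> : (4`! * 3`!)%N = 144%N by [].
by field.
Qed.

(* The Hodge dual of [phi0] for the standard metric and orientation. *)
Definition psi0 (R : realType) : tensor R 7 4 := fun J =>
  6^-1 * \sum_(I : 3.-tuple 'I_7) phi0 R I * dx (ord_tuple 7) [tuple of I ++ J].

Lemma sum_tuple3 (R : realType) n (G : 3.-tuple 'I_n -> R) :
  \sum_I G I = \sum_i \sum_j \sum_k G [tuple i; j; k].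
Proof.
rewrite sum_tupleS; apply: eq_bigr => i _; rewrite sum_tupleS.
apply: eq_bigr => j _; rewrite sum_tupleS; apply: eq_bigr => k _.
rewrite (big_pred1 (nil_tuple 'I_n)) => [|K]; last first.
  by apply/esym/eqP; rewrite [LHS]tuple0 [RHS]tuple0.
by apply: (congr1 G); apply: val_inj.
Qed.

(** Here the psi solved from the product phi_ijb phi_klb is matched with the Hodge dual.
    [hodge_phi0] runs over ordered triples and so counts each set of three indices six times. *)
Lemma psi0E (R : realType) (a b c d : 'I_7) : psi0 R [tuple a; b; c; d]
  = psi_comp R a b c d.
Proof.
rewrite /psi0 sum_tuple3.
have -> : \sum_i \sum_j \sum_k phi0 R [tuple i; j; k] *
    dx (ord_tuple 7) [tuple of [tuple i; j; k] ++ [tuple a; b; c; d]] =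
    (hodge_phi0 a b c d)%:~R.
  rewrite /hodge_phi0 -sum7E; apply: eq_bigr => i _.
  rewrite -sum7E; apply: eq_bigr => j _; rewrite -sum7E; apply: eq_bigr => k _.
  rewrite dx_seq [phi0 _ _]phi0E [map _ (ord_tuple 7)](val_enum_ord 7) /phi_comp;
    cbv zeta.
  by case: (phi_coef i j k =P 0) => [->|_]; rewrite ?mul0r // intrM.
have /eqP -> : hodge_phi0 a b c d == 6 * psi_coef a b c d.
  by refine (@all7_4 (fun a b c d => hodge_phi0 a b c d
    == 6 * psi_coef a b c d) _ a b c d);
    vm_compute.
by rewrite intrM mulrA -pmulrn mulVf ?mul1r // pnatr_eq0.
Qed.

(** * The metric and the dual form in an adapted frame *)

Lemma sum_dx (R : realType) n k (c : k.-tuple 'I_n -> R) (I : k.-tuple 'I_n) :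
  \sum_J c J * dx J I = \sum_(s : 'S_k) (-1) ^+ s * c [tuple tnth I (s r) | r < k].
Proof.
rewrite /dx; under eq_bigr do rewrite mulr_sumr.
rewrite exchange_big; apply: eq_bigr => s _ /=.
under eq_bigr do rewrite mulrCA.
rewrite -mulr_sumr; congr (_ * _); rewrite -tuple_delta.
apply: eq_bigr => J _; rewrite mulrC; congr (_ * _).
by apply: eq_bigr => r _; rewrite !mxE tnth_mktuple eq_sym.
Qed.

Lemma tuple3P (T : Type) (P : 3.-tuple T -> Prop) :
  (forall i j k, P [tuple i; j; k]) -> forall I, P I.
Proof.
move=> h I; case/tupleP: I => i I; case/tupleP: I => j I; case/tupleP: I => k I.
by rewrite (tuple0 I); have := h i j k; congr P; apply: val_inj.
Qed.

Lemma tuple2P (T : Type) (P : 2.-tuple T -> Prop) :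
  (forall i j, P [tuple i; j]) -> forall I, P I.
Proof.
move=> h I; case/tupleP: I => i I; case/tupleP: I => j I.
by rewrite (tuple0 I); have := h i j; congr P; apply: val_inj.
Qed.

Lemma tuple1P (T : Type) (P : 1.-tuple T -> Prop) :
  (forall i, P [tuple i]) -> forall I, P I.
Proof.
move=> h I; case/tupleP: I => i I.
by rewrite (tuple0 I); have := h i; congr P; apply: val_inj.
Qed.

Lemma sum_tuple2 (R : realType) n (G : 2.-tuple 'I_n -> R) :
  \sum_I G I = \sum_i \sum_j G [tuple i; j].
Proof.
rewrite sum_tupleS; apply: eq_bigr => i _; rewrite sum_tupleS.
apply: eq_bigr => j _; rewrite (big_pred1 (nil_tuple 'I_n)) => [|K]; last first.
  by apply/esym/eqP; rewrite [LHS]tuple0 [RHS]tuple0.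
by apply: (congr1 G); apply: val_inj.
Qed.

(** * Component formulas in low degree, and i_phi as a derivation action *)

Section Explicit.
Context {R : realType} {n : nat}.

Lemma act3E (Z : 'M[R]_n) (T : tensor R n 3) i j k : act Z T [tuple i; j; k] =
  \sum_p (Z i p * T [tuple p; j; k] + Z j p * T [tuple i; p; k]
          + Z k p * T [tuple i; j; p]).
Proof.
rewrite /act !big_ord_recl big_ord0 addr0 addrA -!big_split /=.
by apply: eq_bigr => p _; congr (_ * T _ + _ * T _ + _ * T _); apply: val_inj;
  rewrite /= !enum_ordSl enum_ord0.
Qed.

Lemma act2E (Z : 'M[R]_n) (T : tensor R n 2) i j : act Z T [tuple i; j] =
  \sum_p (Z i p * T [tuple p; j] + Z j p * T [tuple i; p]).
Proof.
rewrite /act !big_ord_recl big_ord0 addr0 -!big_split /=.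
by apply: eq_bigr => p _; congr (_ * T _ + _ * T _); apply: val_inj;
  rewrite /= !enum_ordSl enum_ord0.
Qed.

Lemma pullback3E (u : 'M[R]_n) (T : tensor R n 3) i j k :
  pullback u T [tuple i; j; k] =
  \sum_a \sum_b \sum_c u i a * (u j b * (u k c * T [tuple a; b; c])).
Proof.
rewrite /pullback sum_tuple3; apply: eq_bigr => a _; apply: eq_bigr => b _.
by apply: eq_bigr => c _; rewrite !big_ord_recl big_ord0 mulr1 -!mulrA.
Qed.

Lemma pullback2E (u : 'M[R]_n) (T : tensor R n 2) i j :
  pullback u T [tuple i; j] = \sum_a \sum_b u i a * (u j b * T [tuple a; b]).
Proof.
rewrite /pullback sum_tuple2; apply: eq_bigr => a _; apply: eq_bigr => b _.
by rewrite !big_ord_recl big_ord0 mulr1 -!mulrA.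
Qed.

(** The 2-form b_i _| T as a matrix. It makes phi_iab phi_j^ab the trace of a matrix product, to
    which the product rule and the derivative of an inverse matrix apply. *)
Definition mat3 (T : tensor R n 3) i : 'M[R]_n := \matrix_(a, b) T [tuple i; a; b].

Lemma mat3_pullback (u : 'M[R]_n) (T : tensor R n 3) i :
  mat3 (pullback u T) i = \sum_p u i p *: (u *m mat3 T p *m u^T).
Proof.
apply/matrixP => a b; rewrite mxE pullback3E summxE; apply: eq_bigr => p _.
rewrite !mxE mulr_sumr exchange_big; apply: eq_bigr => d _ /=.
rewrite !mxE mulr_suml mulr_sumr; apply: eq_bigr => c _.
by rewrite !mxE; ring.
Qed.

Lemma alternating3P (T : tensor R n 3) :
  alternating T -> alt3 (fun i j k => T [tuple i; j; k]).
Proof.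
have e (i j k : 'I_n) (s : 'S_3) : [seq tnth [tuple i; j; k] (s r) | r <- enum 'I_3] =
    [:: tnth [tuple i; j; k] (s ord0); tnth [tuple i; j; k] (s (lift ord0 ord0));
        tnth [tuple i; j; k] (s (lift ord0 (lift ord0 ord0)))].
  by rewrite !enum_ordSl enum_ord0.
move=> aT; split=> i j k.
  have := aT (tperm ord0 (lift ord0 ord0)) [tuple i; j; k].
  rewrite odd_tperm /= expr1 mulN1r => h; rewrite -[LHS]opprK -h; congr (- T _).
  by apply: val_inj; rewrite /= e tpermL tpermR tpermD.
have := aT (tperm (lift ord0 ord0) (lift ord0 (lift ord0 ord0))) [tuple i; j; k].
rewrite odd_tperm /= expr1 mulN1r => h; rewrite -[LHS]opprK -h; congr (- T _).
by apply: val_inj; rewrite /= e tpermL tpermR tpermD.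
Qed.

(** Evaluating dx^i /\ dx^j /\ dx^k on basis vectors turns the triple sum into a signed sum over
    S_3. Skewness of [ph] in its last two indices makes the six terms agree in pairs, which absorbs
    the 1/2 and leaves one term for each slot of the derivation action. *)
Lemma i_map_act (g h : tensor R n 2) (ph : tensor R n 3) : alternating ph ->
  i_map g ph h =1 act (gram h *m gram_inv g) ph.
Proof.
move=> aph; apply: tuple3P => a b c; rewrite act3E /i_map.
pose W i l := (gram h *m gram_inv g) i l.
pose f i j k := 2^-1 * \sum_l W i l * ph [tuple l; j; k].
transitivity (\sum_(J : 3.-tuple 'I_n)
    f (tnth J ord0) (tnth J (lift ord0 ord0)) (tnth J (lift ord0 (lift ord0 ord0)))
    * dx J [tuple a; b; c]).
  rewrite sum_tuple3; apply: eq_bigr => i _; apply: eq_bigr => j _.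
  apply: eq_bigr => k _; rewrite /tnth /=; congr (_ * _ * _); apply: eq_bigr => l _.
  by congr (_ * _); rewrite /W mxE; apply: eq_bigr => m _; rewrite mxE.
rewrite (sum_dx (fun J : 3.-tuple 'I_n =>
  f (tnth J ord0) (tnth J (lift ord0 ord0)) (tnth J (lift ord0 (lift ord0 ord0))))).
pose G (l : seq 'I_n) := f (nth a l 0) (nth a l 1) (nth a l 2).
transitivity (\sum_(s : 'S_3) (-1) ^+ s * G [seq nth a [:: a; b; c] (s r) |
  r <- enum 'I_3]).
  apply: eq_bigr => s _; congr (_ * _); rewrite !tnth_mktuple /G.
  by rewrite !enum_ordSl enum_ord0 /= !(tnth_nth a).
rewrite sum_perm_rec // !big_ord_recl big_ord0 /=.
rewrite !(@sum_perm_rec _ a _ _ (fun l => G (_ :: l)) [:: _; _]) //.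
rewrite !big_ord_recl !big_ord0.
rewrite !(@sum_perm_rec _ a _ _ (fun l => G (_ :: _ :: l)) [:: _]) //.
rewrite !big_ord_recl !big_ord0.
rewrite !(sum_perm0 (fun s : 'S_0 => G (_ :: _ :: _ :: [seq _ | r <- enum 'I_0]))).
rewrite !enum_ord0 /G /=.
have alt := alternating3P aph.
have e i j k : f i j k = - f i k j.
  rewrite /f -mulrN -sumrN; congr (_ * _); apply: eq_bigr => l _.
  by rewrite [ph [tuple l; j; k]](alt.2 l j k) mulrN.
rewrite ?expr0 ?expr1 ?expr2 ?mul1r ?addr0 (e a c b) (e b a c) (e c b a).
transitivity (2 * f a b c + 2 * f b c a + 2 * f c a b); first by ring.
rewrite /f !mulrA !mulfV ?pnatr_eq0 // !mul1r -!big_split; apply: eq_bigr => p _ /=.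
by rewrite (alt3_cycle alt a p c) -(alt3_cycle alt p a b).
Qed.

Lemma eq_iprod k (v : 'rV[R]_n) (S T : tensor R n k.+1) :
  S =1 T -> iprod v S =1 iprod v T.
Proof. by move=> h I; apply: eq_bigr => l _; rewrite h. Qed.

End Explicit.

(** * Consequences of the equation that defines g and vol *)

Section NormalForm.
Variables (R : realType) (u : 'M[R]_7) (ph : tensor R 7 3) (g : tensor R 7 2)
  (vol : tensor R 7 7).
Hypotheses (uu : u \in unitmx) (ph_u : ph =1 pullback u (phi0 R))
  (g_inner : inner_product g) (vol_unit : unit_volume g vol)
  (g_vol : forall (v w : 'rV[R]_7) (I : 7.-tuple 'I_7),
      (v *m gram g *m w^T) 0 0 * vol I
      = 6^-1 * wedge (wedge (iprod v ph) (iprod w ph)) ph I).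
(** Row q of [P] holds the components of the q-th vector of the adapted frame. *)
Let P := invmx u.

Lemma triple_wedge_frame p q :
  wedge (wedge (iprod (delta_mx 0 p *m P) ph) (iprod (delta_mx 0 q *m P) ph)) ph
    (ord_tuple 7) = 6 * (p == q)%:R * \det u.
Proof.
have ip r : iprod (delta_mx 0 r *m P) ph =1 pullback u (iprod (delta_mx 0 r) (phi0 R)).
  move=> I; rewrite (eq_iprod _ ph_u) iprod_pullback -mulmxA mulVmx // mulmx1 //.
have w1 : wedge (iprod (delta_mx 0 p *m P) ph) (iprod (delta_mx 0 q *m P) ph) =1
    pullback u (wedge (iprod (delta_mx 0 p) (phi0 R)) (iprod (delta_mx 0 q) (phi0 R))).
  by move=> I; rewrite (eq_wedge (ip p) (ip q)) wedge_pullback.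
rewrite (eq_wedge w1 ph_u) wedge_pullback.
set W := wedge _ _.
have WE : W =1 fun I => (6 * (p == q)%:R) * dx (ord_tuple 7) I.
  apply: (@alternating_top_eq R 7); first exact: (@alternating_wedge R 7 (2 + 2) 3).
    exact/alternatingZ/alternating_dx.
  by rewrite dx_id mulr1 /W triple_wedge_phi0.
by rewrite (eq_pullback u WE) pullbackZ pullback_dx_id.
Qed.

(** The defining equation makes the Gram matrix of the adapted frame a multiple l of the identity,
    with det u = l c for c the value of [vol] on the chart basis. Unit length of [vol] gives c^2 =
    det g = l^7 (det u)^2 = l^9 c^2, and l > 0 forces l = 1. Then c = det u, which also settles the
    orientation. *)
Lemma frame_metric : gram g = u *m u^T /\ vol =1 pullback u (dx (ord_tuple 7)).
Proof.
set c := vol (ord_tuple 7); set Q := P *m gram g *m P^T.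
have Qc p q : Q p q * c = (p == q)%:R * \det u.
  have := g_vol (delta_mx 0 p *m P) (delta_mx 0 q *m P) (ord_tuple 7).
  rewrite triple_wedge_frame -!mulrA mulKf ?pnatr_eq0 // => <-.
  congr (_ * _); rewrite trmx_mul trmx_delta !mulmxA.
  rewrite -(mulmxA _ P) -(mulmxA _ _ P^T) -/Q -rowE -colE.
  by rewrite !mxE.
have du : \det u != 0 by rewrite -unitfE -unitmxE.
have c0 : c != 0.
  by apply: contraNneq du => c0; have := Qc ord0 ord0; rewrite c0 mulr0 eqxx mul1r => <-.
pose l := \det u / c.
have QE : Q = l%:M.
  apply/matrixP => p q; rewrite [RHS]mxE; apply: (mulIf c0); rewrite Qc.
  by case: (p == q); rewrite ?mulr1n ?mulr0n ?mul1r ?mul0r // /l divfK.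
have gE : gram g = l *: (u *m u^T).
  have -> : gram g = u *m Q *m u^T.
    rewrite /Q !mulmxA mulmxV // mul1mx -mulmxA -trmx_mul mulmxV // trmx1 mulmx1 //.
  by rewrite QE mul_mx_scalar -scalemxAl.
have l0 : 0 < l.
  have v0 : delta_mx 0 ord0 *m P != 0 :> 'rV[R]_7.
    apply/negP => /eqP /(congr1 (fun v => (v *m u) 0 ord0)).
    rewrite -mulmxA mulVmx // mulmx1 mul0mx !mxE !eqxx => /eqP.
    by rewrite oner_eq0.
  have := g_inner.2 _ v0; rewrite trmx_mul trmx_delta !mulmxA.
  rewrite -(mulmxA _ P) -(mulmxA _ _ P^T) -/Q -rowE -colE QE !mxE.
  by rewrite eqxx mulr1n.
have l1 : l = 1.
  have : l ^+ 9 * c ^+ 2 = c ^+ 2.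
    have c2 : c ^+ 2 = \det (gram g) := vol_unit.2.
    rewrite [RHS]c2 gE detZ det_mulmx det_tr.
    have -> : \det u = l * c by rewrite /l divfK.
    by ring.
  rewrite -[RHS]mul1r => /(mulIf (expf_neq0 2 c0))/eqP.
  by rewrite pexpr_eq1 // ?ltW // => /eqP.
split; first by rewrite gE l1 scale1r.
apply: (@alternating_top_eq R 7); first exact: vol_unit.1.
  exact/alternating_pullback/alternating_dx.
by rewrite pullback_dx_id -/c -(divfK c0 (\det u)) -/l l1 mul1r.
Qed.

Lemma frame_gram_inv : gram_inv g = P^T *m P.
Proof.
have [gE _] := frame_metric.
have e : (P^T *m P) *m (u *m u^T) = 1%:M.
  by rewrite mulmxA -(mulmxA _ P) mulVmx // mulmx1 -trmx_mul mulmxV // trmx1.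
have [_ gu] := mulmx1_unit e.
by rewrite /gram_inv gE -[LHS]mul1mx -e -mulmxA mulmxV // mulmx1.
Qed.

(** Raising the indices of u^* phi0 with P^T P leaves phi0 moved by P^T. [sum_pullback] shifts this
    matrix to the first three slots of the volume form, where it cancels u; the last four slots keep
    their u. *)
Lemma frame_hodge : @hodge R 7 3 4 g vol ph =1 pullback u (psi0 R).
Proof.
have [gE volE] := frame_metric.
move=> J; rewrite /hodge /psi0 pullbackZ; congr (_ * _).
have rE : raise g ph =1 pullback P^T (phi0 R).
  move=> I; rewrite /raise frame_gram_inv (eq_pullback _ ph_u) pullback_comp.
  by rewrite -mulmxA mulVmx // mulmx1.
under eq_bigr do rewrite rE.
pose V (I : 3.-tuple 'I_7) : tensor R 7 4 := fun J => dx (ord_tuple 7) [tuple of I ++ J].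
rewrite sum_pullback trmxK (pullback_sum u (phi0 R) V J).
apply: eq_bigr => I _; congr (_ * _).
rewrite -[RHS](pullbackVK (fun I => pullback u (V I) J) uu).
by apply: eq_pullback => K; rewrite volE (@pullback_cat R 7 3 4).
Qed.

(** An adapted frame reduces this to [contract2_phi_phi]. The resulting identity no longer contains
    [u], which is what allows it to be differentiated. *)
Lemma frame_trace i j :
  \tr (mat3 ph i *m gram_inv g *m (mat3 ph j)^T *m gram_inv g) = 6 * gram g i j.
Proof.
have mE k : mat3 ph k = \sum_p u k p *: (u *m mat3 (phi0 R) p *m u^T).
  by rewrite -mat3_pullback; apply/matrixP => r s; rewrite !mxE ph_u.
have trF p q : \tr (mat3 (phi0 R) p *m (mat3 (phi0 R) q)^T) = 6 * (p == q)%:R.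
  rewrite -[RHS](contract2_phi_phi R p q); apply: eq_bigr => r _; rewrite mxE.
  by apply: eq_bigr => s _; rewrite !mxE !phi0E.
have e p q : \tr (u *m mat3 (phi0 R) p *m u^T *m (P^T *m P)
    *m (u *m mat3 (phi0 R) q *m u^T)^T *m (P^T *m P)) = 6 * (p == q)%:R.
  have Pu : P *m u = 1%:M by rewrite mulVmx.
  have uP : u^T *m P^T = 1%:M by rewrite -trmx_mul Pu trmx1.
  rewrite -trF !trmx_mul trmxK !mulmxA -(mulmxA _ u^T) uP mulmx1.
  rewrite -(mulmxA _ P) Pu mulmx1 -(mulmxA _ u^T) uP mulmx1.
  by rewrite -!mulmxA mxtrace_mulC -!mulmxA Pu mulmx1.
rewrite frame_gram_inv frame_metric.1 mE mulmx_suml mulmx_suml mulmx_suml raddf_sum.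
rewrite mxE mulr_sumr; apply: eq_bigr => p _ /=.
rewrite mE -!scalemxAl mxtraceZ linear_sum /= mulmx_sumr mulmx_suml raddf_sum.
rewrite [u^T _ _]mxE mulrCA; congr (_ * _).
transitivity (\sum_q u j q * (6 * (p == q)%:R)).
  by apply: eq_bigr => q _; rewrite -e linearZ /= -scalemxAr -scalemxAl mxtraceZ.
rewrite -[in RHS](sum_delta p (u j)) mulr_sumr; apply: eq_bigr => q _.
by rewrite mulrC mulrA.
Qed.

End NormalForm.

(** * Transport of the frame identities to the chart *)

Section Transport.
Variables (R : realType) (u : 'M[R]_7).
Hypothesis uu : u \in unitmx.
Let P := invmx u.
Let h := P^T *m P.
Variables (ph : tensor R 7 3) (psi : tensor R 7 4).
Hypotheses (ph_u : ph =1 pullback u (phi0 R)) (psi_u : psi =1 pullback u (psi0 R)).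
Variables (N : 'I_7 -> tensor R 7 3) (X : 'rV[R]_7) (Z : 'M[R]_7).
Hypotheses (altN : forall l, alternating (N l))
  (clN : forall l i j k, N l [tuple i; j; k] - N i [tuple l; j; k]
     + N j [tuple l; i; k] - N k [tuple l; i; j] = 0)
  (metN : forall l i j, \tr (mat3 (N l) i *m h *m (mat3 ph j)^T *m h)
     + \tr (mat3 ph i *m h *m (mat3 (N l) j)^T *m h) = 0).

(** Primed data are components in the adapted frame. In [N'] the derivative index q is transformed
    along with the three form indices. *)
Let X' := X *m u.
Let Z' := P *m Z *m u.
Let N' (q : 'I_7) : tensor R 7 3 := fun I => \sum_l P q l * pullback P (N l) I.
(* [C j] stands for nabla_j (X _| phi) when N = nabla phi and Z = nabla X. *)
Let C (j : 'I_7) : tensor R 7 2 := fun K => iprod (row j Z) ph K + iprod X (N j) K.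
Let delta : 'rV[R]_7 := \row_m (- \sum_i \sum_j h i j * C j [tuple i; m]).
(** As u u^T is the Gram matrix, for Z = nabla X this is L_X g, while [delta] is d^*(X _| phi) when
    in addition N = nabla phi. *)
Let H := Z *m (u *m u^T) + (Z *m (u *m u^T))^T.

Lemma ph_frame : pullback P ph =1 phi0 R.
Proof. by move=> I; rewrite (eq_pullback P ph_u) pullbackVK. Qed.

Lemma mat3_phi0 i : mat3 (phi0 R) i = \sum_p P i p *: (P *m mat3 ph p *m P^T).
Proof.
rewrite -mat3_pullback; apply/matrixP => a b; rewrite !mxE.
by rewrite -ph_frame.
Qed.

Lemma mat3_N' q i : mat3 (N' q) i =
  \sum_l P q l *: \sum_p P i p *: (P *m mat3 (N l) p *m P^T).
Proof.
apply/matrixP => a b; rewrite mxE summxE; apply: eq_bigr => l _.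
by rewrite -mat3_pullback !mxE.
Qed.

(** The inverse metric h = P^T P is absorbed by the frame, tr (P A P^T (P B P^T)^T) = tr (A h B^T
    h); the rest is multilinearity in the three free indices. *)
Lemma metN' q i j :
  \sum_a \sum_b (N' q [tuple i; a; b] * phi_comp R j a b
    + phi_comp R i a b * N' q [tuple j; a; b]) = 0.
Proof.
have trE (A B : 'M[R]_7) : \sum_a \sum_b A a b * B a b = \tr (A *m B^T).
  by apply: eq_bigr => a _; rewrite mxE; apply: eq_bigr => b _; rewrite mxE.
transitivity (\tr (mat3 (N' q) i *m (mat3 (phi0 R) j)^T)
   + \tr (mat3 (phi0 R) i *m (mat3 (N' q) j)^T)).
  rewrite -!trE -big_split; apply: eq_bigr => a _; rewrite -big_split /=.
  by apply: eq_bigr => b _; rewrite !mxE !phi0E.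
have tr4 (A B : 'M[R]_7) : \tr (P *m A *m P^T *m (P *m B *m P^T)^T) =
    \tr (A *m h *m B^T *m h).
  by rewrite !trmx_mul trmxK -!mulmxA mxtrace_mulC /h !mulmxA.
rewrite !mat3_N' !mat3_phi0.
transitivity (\sum_l P q l * \sum_a P i a * \sum_b P j b *
   (\tr (mat3 (N l) a *m h *m (mat3 ph b)^T *m h)
     + \tr (mat3 ph a *m h *m (mat3 (N l) b)^T *m h))); last first.
  rewrite big1 // => l _; rewrite big1 ?mulr0 // => a _; rewrite big1 ?mulr0 // => b _.
  by rewrite metN mulr0.
have trZ x (A B : 'M[R]_7) : \tr ((x *: A) *m B) = x * \tr (A *m B).
  by rewrite -scalemxAl mxtraceZ.
have mxtrace_suml (I : finType) (F : I -> 'M[R]_7) (B : 'M[R]_7) :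
    \tr ((\sum_i F i) *m B) = \sum_i \tr (F i *m B).
  by rewrite mulmx_suml raddf_sum.
have bil x (A B : 'M[R]_7) : \tr (A *m (x *: B)^T) = x * \tr (A *m B^T).
  by rewrite linearZ -scalemxAr mxtraceZ.
have mxtrace_sumr (I : finType) (F : I -> 'M[R]_7) (B : 'M[R]_7) :
    \tr (B *m (\sum_i F i)^T) = \sum_i \tr (B *m (F i)^T).
  by rewrite linear_sum mulmx_sumr raddf_sum.
rewrite mxtrace_suml [X in _ + X]mxtrace_sumr -big_split; apply: eq_bigr => l _ /=.
rewrite trZ bil -mulrDr; congr (_ * _).
rewrite mxtrace_suml [X in _ + X]mxtrace_suml -big_split; apply: eq_bigr => a _ /=.
rewrite !trZ -mulrDr; congr (_ * _).
rewrite !mxtrace_sumr -big_split; apply: eq_bigr => b _ /=.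
by rewrite !bil -mulrDr !tr4.
Qed.

Lemma altN' q : alt3 (fun i j k => N' q [tuple i; j; k]).
Proof.
apply: alternating3P => s I; rewrite /N' mulr_sumr; apply: eq_bigr => l _.
by rewrite (alternating_pullback P (@altN l)) mulrCA.
Qed.

(** After renaming summation indices, one adjacent swap at a time by [sw1], [sw2] and [sw3], all
    four terms carry the same product of entries of P, and [clN] applies under the sum. *)
Lemma clN' l i j k : N' l [tuple i; j; k] - N' i [tuple l; j; k]
  + N' j [tuple l; i; k] - N' k [tuple l; i; j] = 0.
Proof.
pose Q (f : 'I_7 -> 'I_7 -> 'I_7 -> 'I_7 -> R) l i j k := \sum_d \sum_a \sum_b \sum_c
  P l d * (P i a * (P j b * (P k c * f d a b c))).
have sw1 f x y z t : Q f y x z t = Q (fun d a b c => f a d b c) x y z t.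
  rewrite /Q exchange_big; apply: eq_bigr => d _; apply: eq_bigr => a _.
  by apply: eq_bigr => b _; apply: eq_bigr => c _; rewrite mulrCA.
have sw2 f x y z t : Q f x z y t = Q (fun d a b c => f d b a c) x y z t.
  apply: eq_bigr => d _; rewrite exchange_big; apply: eq_bigr => a _.
  by apply: eq_bigr => b _; apply: eq_bigr => c _; rewrite [P z _ * _]mulrCA.
have sw3 f x y z t : Q f x y t z = Q (fun d a b c => f d a c b) x y z t.
  apply: eq_bigr => d _; apply: eq_bigr => a _; rewrite exchange_big.
  by apply: eq_bigr => b _; apply: eq_bigr => c _; rewrite [P t _ * _]mulrCA.
pose n d a b c := N d [tuple a; b; c].
have NQ x y z t : N' x [tuple y; z; t] = Q n x y z t.
  apply: eq_bigr => d _; rewrite pullback3E mulr_sumr; apply: eq_bigr => a _.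
  by rewrite mulr_sumr; apply: eq_bigr => b _; rewrite mulr_sumr.
pose n1 d a b c := n a d b c; pose n2 d a b c := n1 d b a c.
rewrite !NQ (sw1 n l i) (sw1 n l j) (sw2 n1 l i j) (sw1 n l k) (sw2 n1 l i k)
  (sw3 n2 l i j) /Q.
rewrite -!(sumrB, big_split) /=; apply: big1 => d _.
rewrite -!(sumrB, big_split) /=; apply: big1 => a _.
rewrite -!(sumrB, big_split) /=; apply: big1 => b _.
rewrite -!(sumrB, big_split) /=; apply: big1 => c _.
by rewrite -!mulrBr -!mulrDr -!mulrBr /n2 /n1 /n clN !mulr0.
Qed.

Lemma row_sum_pullback (I : 3.-tuple 'I_7) :
  \sum_l X 0 l * N l I = pullback u (fun K => \sum_q X' 0 q * N' q K) I.
Proof.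
rewrite pullback_sum.
transitivity (\sum_q X' 0 q * \sum_l P q l * N l I); last first.
  apply: eq_bigr => q _; congr (_ * _); rewrite pullback_sum; apply: eq_bigr => l _.
  by rewrite pullbackK.
transitivity (\sum_l (X' *m P) 0 l * N l I).
  by rewrite /X' -mulmxA mulmxV // mulmx1.
under eq_bigr do rewrite mxE mulr_suml.
rewrite exchange_big; apply: eq_bigr => q _; rewrite mulr_sumr.
by apply: eq_bigr => l _; rewrite mulrA.
Qed.

Lemma trmx_unitVK : u^T *m P^T = 1%:M.
Proof. by rewrite -trmx_mul mulVmx // trmx1. Qed.

Lemma trmx_unitK : P^T *m u^T = 1%:M.
Proof. by rewrite -trmx_mul mulmxV // trmx1. Qed.

Lemma H_frame : H *m P^T = u *m (Z' + Z'^T).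
Proof.
rewrite /H /Z' mulmxDl mulmxDr !trmx_mul trmxK -!mulmxA trmx_unitVK mulmx1.
by rewrite !mulmxA mulmxV // mul1mx.
Qed.

Lemma act_H : act (H *m h) ph =1 pullback u (act (Z' + Z'^T) (phi0 R)).
Proof.
move=> I; rewrite (eq_act _ ph_u); apply: act_pullback.
by rewrite /h -!mulmxA mulVmx // mulmx1 H_frame.
Qed.

Lemma act_Z : act Z ph =1 pullback u (act Z' (phi0 R)).
Proof.
move=> I; rewrite (eq_act _ ph_u); apply: act_pullback.
by rewrite /Z' !mulmxA mulmxV // mul1mx.
Qed.

Lemma iprod_psi : iprod (delta *m h) psi =1 pullback u (iprod (delta *m P^T) (psi0 R)).
Proof.
move=> I; rewrite (eq_iprod _ psi_u) iprod_pullback.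
by rewrite /h -!mulmxA mulVmx // mulmx1.
Qed.

Lemma iprod_sum k (I : finType) (c : I -> R) (v : I -> 'rV[R]_7) (T : tensor R 7 k.+1) :
  iprod (\sum_i c i *: v i) T =1 fun K => \sum_i c i * iprod (v i) T K.
Proof.
move=> K; rewrite /iprod; under eq_bigr do rewrite summxE mulr_suml.
rewrite exchange_big; apply: eq_bigr => i _; rewrite mulr_sumr.
by apply: eq_bigr => l _; rewrite mxE mulrA.
Qed.

Lemma C_frame a K : iprod (row a Z') (phi0 R) K + iprod X' (N' a) K =
  \sum_j P a j * pullback P (C j) K.
Proof.
transitivity (\sum_j P a j * pullback P (iprod (row j Z) ph) K
    + \sum_j P a j * pullback P (iprod X (N j)) K); last first.
  rewrite -big_split; apply: eq_bigr => j _ /=.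
  by rewrite -mulrDr -pullbackD.
congr (_ + _).
  rewrite -(eq_iprod _ ph_frame) iprod_pullback -row_mul.
  have -> : Z' *m P = P *m Z by rewrite /Z' -!mulmxA mulmxV // mulmx1.
  have -> : row a (P *m Z) = \sum_j P a j *: row j Z.
    by rewrite row_mul mulmx_sum_row; apply: eq_bigr => j _; rewrite mxE.
  rewrite (eq_pullback P (iprod_sum _ _ ph)) pullback_sum //.
transitivity (\sum_j P a j * iprod X' (pullback P (N j)) K); last first.
  apply: eq_bigr => j _; rewrite iprod_pullback /X' -mulmxA mulmxV // mulmx1 //.
rewrite /iprod /N'; under eq_bigr do rewrite mulr_sumr.
rewrite exchange_big; apply: eq_bigr => j _; rewrite mulr_sumr.
by apply: eq_bigr => l _; rewrite mulrCA.
Qed.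

Lemma delta_frame m : (delta *m P^T) 0 m =
  - \sum_a (\sum_l Z' a l * phi_comp R l a m + \sum_l X' 0 l * N' a [tuple l; a; m]).
Proof.
transitivity (- \sum_a \sum_j P a j * pullback P (C j) [tuple a; m]); last first.
  congr (- _); apply: eq_bigr => a _; rewrite -C_frame; congr (_ + _).
    by apply: eq_bigr => l _; rewrite mxE -phi0E; congr (_ * _).
rewrite mxE -sumrN.
transitivity (\sum_m0 \sum_a \sum_i \sum_j
   - (P a j * (P a i * (P m m0 * C j [tuple i; m0])))).
  apply: eq_bigr => m0 _; rewrite !mxE mulNr mulr_suml -sumrN.
  rewrite [RHS]exchange_big; apply: eq_bigr => i _; rewrite mulr_suml -sumrN.
  rewrite [RHS]exchange_big; apply: eq_bigr => j _; rewrite mxE.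
  rewrite !mulr_suml -sumrN; apply: eq_bigr => a _; rewrite !mxE.
  by ring.
rewrite exchange_big; apply: eq_bigr => a _.
rewrite exchange_big -sumrN.
transitivity (\sum_i \sum_j \sum_m0 - (P a j * (P a i * (P m m0 * C j [tuple i; m0])))).
  by apply: eq_bigr => i _; rewrite exchange_big.
rewrite exchange_big; apply: eq_bigr => j _.
rewrite pullback2E mulr_sumr -sumrN; apply: eq_bigr => i _.
by rewrite mulr_sumr -sumrN.
Qed.

Let S := Z' + Z'^T.

Lemma act_phi0E (W : 'M[R]_7) i j k :
  act W (phi0 R) [tuple i; j; k] = deriv_phi0 (fun a b => W a b) i j k.
Proof. by rewrite act3E; apply: eq_bigr => p _; rewrite !phi0E. Qed.

Lemma iprod_psi0E (v : 'rV[R]_7) i j k :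
  iprod v (psi0 R) [tuple i; j; k] = \sum_m v 0 m * psi_comp R m i j k.
Proof.
apply: eq_bigr => m _; rewrite -psi0E; congr (_ * _).
Qed.

Lemma transport_identity I : \sum_l X 0 l * N l I + act Z ph I =
  2^-1 * act (H *m h) ph I + 2^-1 * iprod (delta *m h) psi I.
Proof.
rewrite row_sum_pullback act_Z act_H iprod_psi -!pullbackZ -!pullbackD.
apply: eq_pullback; apply: tuple3P => i j k.
rewrite !act_phi0E iprod_psi0E.
under [X in _ = _ + 2^-1 * X]eq_bigr do rewrite delta_frame.
rewrite (@frame_identity _ (fun q i j k => N' q [tuple i; j; k]) (fun q => X' 0 q)
  (fun a b => Z' a b) altN' clN' metN').
by congr (_ * _ + _); apply: eq_bigr => p _; rewrite !mxE.
Qed.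

Lemma transport_inj : (forall I, act (H *m h) ph I + iprod (delta *m h) psi I = 0) ->
  H = 0 /\ delta = 0.
Proof.
move=> h0.
have [S0 d0] : (forall i j, (Z' + Z'^T) i j = 0) /\ (forall m, (delta *m P^T) 0 m = 0).
  apply: deriv_phi0_inj => [i j|i j k]; first by rewrite !mxE addrC.
  rewrite -act_phi0E -iprod_psi0E.
  pose T := fun K => act (Z' + Z'^T) (phi0 R) K + iprod (delta *m P^T) (psi0 R) K.
  rewrite -/(T [tuple i; j; k]) -(pullbackVK T uu).
  have T0 : pullback u T =1 fun=> 0.
    by move=> K; rewrite pullbackD -act_H -iprod_psi h0.
  rewrite (eq_pullback _ T0) /pullback big1 // => J _; by rewrite mulr0.
split.
  rewrite -[H]mulmx1 -trmx_unitK mulmxA H_frame (_ : Z' + Z'^T = 0) ?mulmx0 ?mul0mx //.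
  by apply/matrixP => i j; rewrite S0 mxE.
rewrite -[delta]mulmx1 -trmx_unitK mulmxA (_ : delta *m P^T = 0) ?mul0mx //.
by apply/rowP => m; rewrite d0 mxE.
Qed.

End Transport.

(** * Partial derivatives in a chart *)

Section Calculus.
Local Open Scope classical_set_scope.
Context {R : realType} {n : nat} {M : topologicalType} (A : smooth_atlas R n M).
Variables (a : chart A) (x : M).
Hypothesis ax : dom a x.

(** Existence of the derivative together with its value: [partial] is total and its value alone does
    not certify differentiability, which the sum and product rules require. *)
Definition has_partial i (f : M -> R) (d : R) : Prop :=
  is_derive (crd a x) (delta_mx 0 i : 'rV[R]_n) (f \o inv a) d.

Lemma has_partialE i f d : has_partial i f d -> partial a i f x = d.
Proof. by move=> [_ <-]. Qed.

(** The image of a chart is open, so a partial derivative depends only on the values over [dom a],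
    where the components of a field are meaningful. *)
Lemma near_dom : \forall z \near crd a x, dom a (inv a z).
Proof.
have : nbhs (crd a x) (crd a @` dom a).
  by apply: open_nbhs_nbhs; split; [exact: cod_open | exists x].
by apply: filterS => _ [y ay <-]; rewrite crdK.
Qed.

Lemma has_partial_ext i f f' d : (forall y, dom a y -> f y = f' y) ->
  has_partial i f d -> has_partial i f' d.
Proof.
move=> e [df Df]; have ne : \forall z \near crd a x, (f \o inv a) z = (f' \o inv a) z.
  by apply: filterS near_dom => z /e.
split; first exact: near_eq_derivable df.
by rewrite -(near_eq_derive _ ne).
Qed.

Lemma partial_ext i f f' : (forall y, dom a y -> f y = f' y) ->
  partial a i f x = partial a i f' x.
Proof.
move=> e; apply: near_eq_derive; apply: filterS near_dom => z; exact: e.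
Qed.

Lemma has_partial_smooth i f : smooth_in a f -> has_partial i f (partial a i f x).
Proof.
move=> /(_ 1%N)[_ /(_ i)[df _]]; split=> //.
by apply: df; exists x.
Qed.

Lemma has_partial_cst i c : has_partial i (fun=> c) 0.
Proof. exact: is_derive_cst. Qed.

Lemma has_partialD i f g df dg : has_partial i f df -> has_partial i g dg ->
  has_partial i (fun y => f y + g y) (df + dg).
Proof. by move=> hf hg; exact: is_deriveD. Qed.

Lemma has_partialM i f g df dg : has_partial i f df -> has_partial i g dg ->
  has_partial i (fun y => f y * g y) (df * g x + f x * dg).
Proof.
move=> hf hg; have := is_deriveM hf hg.
by rewrite /= !crdK // addrC [g x *: _]mulrC.
Qed.

Lemma has_partial_sum i (I : finType) (F : I -> M -> R) (dF : I -> R) :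
  (forall k, has_partial i (F k) (dF k)) ->
  has_partial i (fun y => \sum_k F k y) (\sum_k dF k).
Proof.
move=> h; elim: (index_enum I) => [|k r IH].
  rewrite big_nil (_ : (fun y => _) = fun=> 0); first exact: has_partial_cst.
  by apply/funext => y; rewrite big_nil.
rewrite big_cons (_ : (fun y => _) = fun y => F k y + \sum_(j <- r) F j y).
  exact: has_partialD.
by apply/funext => y; rewrite big_cons.
Qed.

Lemma ex_partial_prod i (I : finType) (F : I -> M -> R) :
  (forall k, exists d, has_partial i (F k) d) ->
  exists d, has_partial i (fun y => \prod_k F k y) d.
Proof.
move=> h; elim: (index_enum I) => [|k r [d IH]].
  exists 0; rewrite (_ : (fun y => _) = fun=> 1); first exact: has_partial_cst.
  by apply/funext => y; rewrite big_nil.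
have [dk hk] := h k.
eexists; rewrite (_ : (fun y => _) = fun y => F k y * \prod_(j <- r) F j y).
  exact: (has_partialM hk IH).
by apply/funext => y; rewrite big_cons.
Qed.

Lemma ex_partial_sum i (I : finType) (F : I -> M -> R) :
  (forall k, exists d, has_partial i (F k) d) ->
  exists d, has_partial i (fun y => \sum_k F k y) d.
Proof.
by move=> /fin_all_exists[dF h]; exists (\sum_k dF k); exact: has_partial_sum.
Qed.

Lemma ex_partialM i f g : (exists d, has_partial i f d) ->
  (exists d, has_partial i g d) -> exists d, has_partial i (fun y => f y * g y) d.
Proof. by move=> [df hf] [dg hg]; eexists; exact: has_partialM hf hg. Qed.

Lemma ex_partial_cst i c : exists d, has_partial i (fun=> c) d.
Proof. by exists 0; exact: has_partial_cst. Qed.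

Lemma ex_partialV i f : f x != 0 -> (exists d, has_partial i f d) ->
  exists d, has_partial i (fun y => (f y)^-1) d.
Proof.
move=> fx [d [df _]]; exists (partial a i (fun y => (f y)^-1) x); split=> //.
by apply: (@derivableV _ _ (f \o inv a)) => //=; rewrite crdK.
Qed.

Definition has_partial_mx k m i (B : M -> 'M[R]_(k, m)) (dB : 'M[R]_(k, m)) : Prop :=
  forall r s, has_partial i (fun y => B y r s) (dB r s).

Lemma has_partial_mxM k m l i (B : M -> 'M[R]_(k, m)) (C : M -> 'M[R]_(m, l)) dB dC :
  has_partial_mx i B dB -> has_partial_mx i C dC ->
  has_partial_mx i (fun y => B y *m C y) (dB *m C x + B x *m dC).
Proof.
move=> hB hC r s; rewrite !mxE -big_split /=.
rewrite (_ : (fun y => _) = fun y => \sum_j B y r j * C y j s).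
  by apply: has_partial_sum => j; exact: has_partialM.
by apply/funext => y; rewrite mxE.
Qed.

Lemma has_partial_mx_tr k m i (B : M -> 'M[R]_(k, m)) dB :
  has_partial_mx i B dB -> has_partial_mx i (fun y => (B y)^T) dB^T.
Proof.
move=> hB r s; rewrite mxE (_ : (fun y => _) = fun y => B y s r) //.
by apply/funext => y; rewrite mxE.
Qed.

Lemma has_partial_mxtrace k i (B : M -> 'M[R]_k) dB :
  has_partial_mx i B dB -> has_partial i (fun y => \tr (B y)) (\tr dB).
Proof. by move=> hB; apply: has_partial_sum => j; exact: hB. Qed.

Lemma ex_partial_det k i (B : M -> 'M[R]_k) :
  (forall r s, exists d, has_partial i (fun y => B y r s) d) ->
  exists d, has_partial i (fun y => \det (B y)) d.
Proof.
move=> h; apply: ex_partial_sum => s; apply: ex_partialM; first exact: ex_partial_cst.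
by apply: ex_partial_prod.
Qed.

(** The cofactor formula shows that the entries of the inverse have partial derivatives; their value
    then follows by differentiating B^-1 B = 1. *)
Lemma has_partial_invmx k i (B : M -> 'M[R]_k) dB :
  (forall y, dom a y -> B y \in unitmx) -> has_partial_mx i B dB ->
  has_partial_mx i (fun y => invmx (B y)) (- (invmx (B x) *m dB *m invmx (B x))).
Proof.
move=> uB hB.
have exV r s : exists d, has_partial i (fun y => invmx (B y) r s) d.
  have [d hd] : exists d, has_partial i (fun y => (\det (B y))^-1 * \adj (B y) r s) d.
    apply: ex_partialM.
      apply: ex_partialV; first by rewrite -unitfE -unitmxE; exact: uB.
      by apply: ex_partial_det => p q; exists (dB p q); exact: hB.
    rewrite (_ : (fun y => _) = fun y => (-1) ^+ (s + r) * \det (row' s (col' r (B y)))).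
      apply: ex_partialM; first exact: ex_partial_cst.
      apply: ex_partial_det => p q; exists (dB (lift s p) (lift r q)).
      by rewrite (_ : (fun y => _) = fun y => B y (lift s p) (lift r q)) //;
        apply/funext => y; rewrite !mxE.
    by apply/funext => y; rewrite mxE.
  exists d; apply: has_partial_ext hd => y ay.
  by rewrite /invmx uB // [RHS]mxE.
have [D hD] : exists D : 'M[R]_k, has_partial_mx i (fun y => invmx (B y)) D.
  have /fin_all_exists[D hD] r := fin_all_exists (exV r).
  by exists (\matrix_(r, s) D r s) => r s; rewrite mxE.
suff <- : D = - (invmx (B x) *m dB *m invmx (B x)) by [].
have h1 : D *m B x + invmx (B x) *m dB = 0.
  apply/matrixP => r s; rewrite [RHS]mxE.
  rewrite -(has_partialE (has_partial_mxM hD hB r s)).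
  rewrite (@partial_ext i _ (fun=> (1%:M : 'M[R]_k) r s)) => [|y ay].
    exact: has_partialE (has_partial_cst _ _).
  by rewrite mulVmx // uB.
apply/eqP; rewrite -addr_eq0; apply/eqP.
by rewrite -[D in LHS](mulmxK (uB x ax)) -mulmxDl h1 mul0mx.
Qed.

End Calculus.

(** * The Levi-Civita connection *)

Section ActLinear.
Context {R : realType} {n : nat}.

Lemma actD k (Z W : 'M[R]_n) (T : tensor R n k) I :
  act (Z + W) T I = act Z T I + act W T I.
Proof.
rewrite /act -big_split; apply: eq_bigr => r _; rewrite -big_split.
by apply: eq_bigr => p _; rewrite mxE mulrDl.
Qed.

Lemma actZ k c (Z : 'M[R]_n) (T : tensor R n k) I : act (c *: Z) T I = c * act Z T I.
Proof.
rewrite /act mulr_sumr; apply: eq_bigr => r _; rewrite mulr_sumr.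
by apply: eq_bigr => p _; rewrite mxE mulrA.
Qed.

Lemma act_sum k (J : finType) (Z : J -> 'M[R]_n) (T : tensor R n k) I :
  act (\sum_j Z j) T I = \sum_j act (Z j) T I.
Proof.
elim: (index_enum J) => [|j r IH]; last by rewrite !big_cons actD IH.
rewrite !big_nil /act big1 // => r _; rewrite big1 // => p _.
by rewrite mxE mul0r.
Qed.

Lemma alternating_act k (Z : 'M[R]_n) (T : tensor R n k) :
  alternating T -> alternating (act Z T).
Proof.
move=> aT s I; rewrite /act mulr_sumr [RHS](reindex_inj (@perm_inj _ s)) /=.
apply: eq_bigr => r _; rewrite mulr_sumr; apply: eq_bigr => p _.
rewrite tnth_mktuple mulrCA -aT; congr (_ * T _).
apply: eq_from_tnth => t; rewrite !tnth_mktuple (inj_eq perm_inj).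
by case: ifP.
Qed.

(** tr (B h C^T h) is invariant under a change of frame. To first order S changes the covariant B
    and C as here and the inverse metric h by -(h S + S^T h), so the four contributions cancel. *)
Lemma tr_product_rule (S h B C : 'M[R]_n) :
  \tr ((S *m B + B *m S^T) *m h *m C^T *m h)
  + \tr (B *m - (h *m S + S^T *m h) *m C^T *m h)
  + \tr (B *m h *m (S *m C + C *m S^T)^T *m h)
  + \tr (B *m h *m C^T *m - (h *m S + S^T *m h)) = 0.
Proof.
have trN (B' : 'M[R]_n) : \tr (- B') = - \tr B'.
  by rewrite -scaleN1r mxtraceZ mulN1r.
have -> : (S *m B + B *m S^T) *m h *m C^T *m h =
    S *m B *m h *m C^T *m h + B *m S^T *m h *m C^T *m h by rewrite !mulmxDl.
have -> : B *m - (h *m S + S^T *m h) *m C^T *m h =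
    - (B *m h *m S *m C^T *m h + B *m S^T *m h *m C^T *m h).
  by rewrite mulmxN !mulNmx mulmxDr !mulmxDl !mulmxA.
have -> : B *m h *m (S *m C + C *m S^T)^T *m h =
    B *m h *m C^T *m S^T *m h + B *m h *m S *m C^T *m h.
  by rewrite raddfD /= !trmx_mul trmxK mulmxDr mulmxDl !mulmxA.
have -> : B *m h *m C^T *m - (h *m S + S^T *m h) =
    - (B *m h *m C^T *m h *m S + B *m h *m C^T *m S^T *m h).
  by rewrite mulmxN mulmxDr !mulmxA.
rewrite !(trN, mxtraceD) [\tr (S *m B *m h *m C^T *m h)](_ : _
  = \tr (B *m h *m C^T *m h *m S)).
  by ring.
by rewrite -!mulmxA mxtrace_mulC !mulmxA.
Qed.

Lemma tr_product_split (h B C U V W1 W2 E1 E2 K : 'M[R]_n) :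
  \tr ((((U + W1 + E1) *m h + B *m K) *m C^T + B *m h *m (V + W2 + E2)^T) *m h
    + B *m h *m C^T *m K) =
  (\tr (U *m h *m C^T *m h) + \tr (B *m h *m V^T *m h))
  + (\tr (W1 *m h *m C^T *m h) + \tr (B *m K *m C^T *m h)
     + \tr (B *m h *m W2^T *m h) + \tr (B *m h *m C^T *m K))
  + (\tr (E1 *m h *m C^T *m h) + \tr (B *m h *m E2^T *m h)).
Proof.
have tD (S S' : 'M[R]_n) : (S + S')^T = S^T + S'^T by rewrite raddfD.
rewrite !tD !mulmxDl !mulmxDr !mulmxDl !mxtraceD.
by ring.
Qed.

Lemma mat3_act (S : 'M[R]_n) (T : tensor R n 3) m : mat3 (act S T) m =
  S *m mat3 T m + mat3 T m *m S^T + \sum_p S m p *: mat3 T p.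
Proof.
apply/matrixP => r s; rewrite mxE act3E !mxE summxE -!big_split /=.
by apply: eq_bigr => p _; rewrite !mxE; ring.
Qed.

(** Symmetric connection coefficients against a skew T: the terms cancel in pairs. This is why the
    alternation of nabla phi is that of the partial derivatives. *)
Lemma sum_torsion_free (c : 'I_n -> 'I_n -> 'I_n -> R) (T : 'I_n -> 'I_n -> 'I_n -> R)
    l i j k : (forall l i p, c l i p = c i l p) -> alt3 T ->
  \sum_p (c l i p * T p j k + c l j p * T i p k + c l k p * T i j p)
  - \sum_p (c i l p * T p j k + c i j p * T l p k + c i k p * T l j p)
  + \sum_p (c j l p * T p i k + c j i p * T l p k + c j k p * T l i p)
  - \sum_p (c k l p * T p i j + c k i p * T l p j + c k j p * T l i p) = 0.
Proof.
move=> cC aT; rewrite -!(sumrB, big_split) /=; apply: big1 => p _.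
rewrite (cC i l) (cC j l) (cC k l) (cC j i) (cC k i) (cC k j).
by rewrite (aT.1 i p k) (aT.2 l j p) -(alt3_cycle aT p i j); ring.
Qed.

Lemma tr_derivative (h S B C U V E1 E2 : 'M[R]_n) :
  \tr ((((U + (S *m B + B *m S^T) + E1) *m h + B *m - (h *m S + S^T *m h)) *m C^T
     + B *m h *m (V + (S *m C + C *m S^T) + E2)^T) *m h
    + B *m h *m C^T *m - (h *m S + S^T *m h)) =
  (\tr (U *m h *m C^T *m h) + \tr (B *m h *m V^T *m h))
  + (\tr (E1 *m h *m C^T *m h) + \tr (B *m h *m E2^T *m h)).
Proof.
rewrite (tr_product_split h B C U V _ _ E1 E2 (- (h *m S + S^T *m h))).
by rewrite (tr_product_rule S h B C) addr0.
Qed.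

Lemma mxtrace_suml (I : finType) (c : I -> R) (F : I -> 'M[R]_n) (B C D : 'M[R]_n) :
  \tr ((\sum_i c i *: F i) *m B *m C *m D) = \sum_i c i * \tr (F i *m B *m C *m D).
Proof.
rewrite !mulmx_suml raddf_sum; apply: eq_bigr => i _ /=.
by rewrite -!scalemxAl mxtraceZ.
Qed.

Lemma mxtrace_sumr (I : finType) (c : I -> R) (F : I -> 'M[R]_n) (B D : 'M[R]_n) :
  \tr (B *m (\sum_i c i *: F i)^T *m D) = \sum_i c i * \tr (B *m (F i)^T *m D).
Proof.
rewrite linear_sum mulmx_sumr mulmx_suml raddf_sum; apply: eq_bigr => i _ /=.
by rewrite linearZ -scalemxAr -scalemxAl mxtraceZ.
Qed.

End ActLinear.

(** * Covariant and Lie derivatives in a chart *)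

Section Connection.
Local Open Scope classical_set_scope.
Context {R : realType} {n : nat} {M : topologicalType} (A : smooth_atlas R n M).
Variables (g : tensor_field A 2) (X : vector_field A).
Hypotheses (g_metric : riemannian_metric g) (sX : smooth_vector_field X).
Variables (a : chart A) (x : M).
Hypothesis ax : dom a x.

(** For a fixed direction l the Christoffel symbols form an endomorphism, and nabla_l is the partial
    derivative minus its derivation action. *)
Definition conn (l : 'I_n) : 'M[R]_n := \matrix_(i, p) christoffel g a x p l i.

Definition dgram (l : 'I_n) : 'M[R]_n :=
  \matrix_(i, j) partial a l (fun y => g a y [tuple i; j]) x.

(** nabla_i X^p, with X contracted into the first lower index of the Christoffel symbol: this is the
    order in which the connection terms of L_X appear. The usual order is the same by [conn_sym]. *)
Definition nablaX : 'M[R]_n :=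
  (\matrix_(i, p) partial a i (fun y => X a y 0 p) x) + \sum_l X a x 0 l *: conn l.

Lemma gram_sym y : dom a y -> (gram (g a y))^T = gram (g a y).
Proof. by move=> ay; case: (g_metric.2 _ _ ay). Qed.

Lemma gram_swap y i j : dom a y -> g a y [tuple i; j] = g a y [tuple j; i].
Proof. by move=> /gram_sym/matrixP/(_ j i); rewrite !mxE. Qed.

Lemma gram_unit y : dom a y -> gram (g a y) \in unitmx.
Proof.
move=> ay; rewrite -row_free_unit -kermx_eq0; apply/rowV0P => v /sub_kermxP vg.
apply/eqP/negPn/negP => v0; have := (g_metric.2 _ _ ay).2 v v0.
by rewrite vg mul0mx mxE ltxx.
Qed.

Lemma dg_swap l i j : partial a l (fun y => g a y [tuple i; j]) x =
  partial a l (fun y => g a y [tuple j; i]) x.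
Proof. by apply: partial_ext => // y ay; exact: gram_swap. Qed.

Lemma conn_sym l i p : conn l i p = conn i l p.
Proof.
rewrite !mxE /christoffel; congr (_ * _); apply: eq_bigr => m _.
by congr (_ * _); rewrite (dg_swap _ l i); ring.
Qed.

(** Multiplication by the metric cancels the inverse metric in [christoffel] and leaves Koszul's
    formula for coordinate fields. *)
Lemma conn_gram l i q : (conn l *m gram (g a x)) i q = 2^-1 *
  (partial a l (fun y => g a y [tuple i; q]) x
   + partial a i (fun y => g a y [tuple l; q]) x
   - partial a q (fun y => g a y [tuple l; i]) x).
Proof.
pose K m := partial a l (fun y => g a y [tuple i; m]) x
   + partial a i (fun y => g a y [tuple l; m]) x
   - partial a m (fun y => g a y [tuple l; i]) x.
have -> : conn l *m gram (g a x) =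
    2^-1 *: (\matrix_(i, p) \sum_m (gram_inv (g a x)) p m *
     (partial a l (fun y => g a y [tuple i; m]) x
     + partial a i (fun y => g a y [tuple l; m]) x
     - partial a m (fun y => g a y [tuple l; i]) x)) *m gram (g a x).
  by congr (_ *m _); apply/matrixP => r s; rewrite !mxE.
rewrite -scalemxAl mxE; congr (_ * _).
transitivity (((\row_m K m) *m (gram_inv (g a x))^T *m gram (g a x)) 0 q); last first.
  have e : (gram_inv (g a x))^T *m gram (g a x) = 1%:M.
    by rewrite -[X in _ *m X]gram_sym // -trmx_mul mulmxV ?gram_unit // trmx1.
  by rewrite -mulmxA e mulmx1 mxE.
rewrite !mxE; apply: eq_bigr => p _; congr (_ * _); rewrite !mxE.
by apply: eq_bigr => m _; rewrite !mxE mulrC.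
Qed.

Lemma conn_metric l : dgram l = conn l *m gram (g a x) + (conn l *m gram (g a x))^T.
Proof.
apply/matrixP => i q; rewrite [RHS]mxE [X in _ + X]mxE !conn_gram mxE.
by rewrite (dg_swap l q i); field.
Qed.

Lemma cov_derivE k (T : tensor_field A k) l I : cov_deriv g T a x l I =
  partial a l (fun y => T a y I) x - act (conn l) (T a x) I.
Proof.
congr (_ - _); apply: eq_bigr => r _; apply: eq_bigr => p _.
by rewrite mxE.
Qed.

Lemma act_g (Z : 'M[R]_n) i j : act Z (g a x) [tuple i; j] =
  (Z *m gram (g a x) + (Z *m gram (g a x))^T) i j.
Proof.
rewrite act2E big_split /= mxE [X in _ = _ + X]mxE 2!mxE; congr (_ + _).
  by apply: eq_bigr => p _; rewrite [gram _ _ _]mxE.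
by apply: eq_bigr => p _; rewrite [gram _ _ _]mxE gram_swap.
Qed.

Lemma cov_deriv_g l I : cov_deriv g g a x l I = 0.
Proof.
move: I; apply: tuple2P => i j.
by rewrite cov_derivE act_g -conn_metric mxE subrr.
Qed.

Lemma partial_const i (c : R) : partial a i (fun=> c) x = 0.
Proof. exact: has_partialE (has_partial_cst a x i c). Qed.

(** In coordinates L_X T is the derivative of the components along X plus the action of the matrix
    of partial derivatives of X. Adding X^l [conn l] to that matrix compensates for replacing
    partial by covariant derivatives. *)
Lemma lie_derivativeE k (T : tensor_field A k) I : lie_derivative X T a x I =
  \sum_l X a x 0 l * cov_deriv g T a x l I + act nablaX (T a x) I.
Proof.
pose DX : 'M[R]_n := \matrix_(i, p) partial a i (fun y => X a y 0 p) x.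
transitivity (\sum_l X a x 0 l * partial a l (fun y => T a y I) x + act DX (T a x) I).
  rewrite /lie_derivative; congr (_ + _).
    apply: eq_bigr => l _; congr (_ * partial a l _ x); apply/funext => y.
    rewrite /eval -[RHS]tuple_delta; apply: eq_bigr => J _; rewrite mulrC; congr (_ * _).
    by apply: eq_bigr => r _; rewrite mxE eqxx eq_sym.
  have -> : act DX (T a x) I = - act (- DX) (T a x) I.
    by rewrite -[- DX]scaleN1r actZ mulN1r opprK.
  rewrite act_mpull; congr (- _); apply: eq_bigr => r _; apply: eq_bigr => J _.
  rewrite mulrC; congr (_ * _); apply: eq_bigr => s _.
  case: eqVneq => [->|_]; last by rewrite !mxE eqxx eq_sym.
  (* Coordinate fields have constant components, so their bracket with X reduces to minus a partial
     derivative of X. *)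
  rewrite /lie_bracket !mxE.
  transitivity (\sum_j - ((tnth I r == j)%:R * partial a j (fun y =>
    X a y 0 (tnth J r)) x)).
    apply: eq_bigr => j _; rewrite partial_const mulr0 sub0r mxE eqxx /=.
    by rewrite eq_sym.
  by rewrite sumrN sum_delta.
under [in RHS]eq_bigr do rewrite cov_derivE mulrBr.
rewrite sumrB -addrA; congr (_ + _).
rewrite actD act_sum [in RHS]addrCA; under [X in _ = _ + (_ + X)]eq_bigr do rewrite actZ.
by rewrite addNr addr0.
Qed.

Lemma lie_derivative_g i j : lie_derivative X g a x [tuple i; j] =
  (nablaX *m gram (g a x) + (nablaX *m gram (g a x))^T) i j.
Proof.
rewrite lie_derivativeE act_g big1 ?add0r // => l _.
by rewrite cov_deriv_g mulr0.
Qed.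

Section ThreeForm.
Variable T : tensor_field A 3.
Hypothesis sT : differential_form T.

Let N l := cov_deriv g T a x l.

Lemma alternating_cov_deriv l : alternating (N l).
Proof.
move=> s I; rewrite /N !cov_derivE mulrBr (alternating_act _ (sT.2 _ _ ax));
  congr (_ - _).
have /has_partialE <- : has_partial a x l
    (fun y => (-1) ^+ s * T a y I) ((-1) ^+ s * partial a l (fun y => T a y I) x).
  have := has_partialM ax (has_partial_cst a x l ((-1) ^+ s))
    (has_partial_smooth ax l (sT.1.2 a I)).
  by rewrite mul0r add0r.
by apply: partial_ext => // y ay; rewrite (sT.2 a y ay).
Qed.

(** Leibniz rule for the contraction: the connection part of [nablaX] cancels the connection term on
    the contracted slot of T, the lower indices being matched by [conn_sym]. *)
Lemma cov_deriv_iprod j i m : cov_deriv g (iprod_field X T) a x j [tuple i; m] =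
  iprod (row j nablaX) (T a x) [tuple i; m] + iprod (X a x) (N j) [tuple i; m].
Proof.
have hp := has_partial_sum (fun l => has_partialM ax
  (has_partial_smooth ax j (sX.2 a l)) (has_partial_smooth ax j (sT.1.2 a [tuple l; i;
    m]))).
rewrite cov_derivE act2E.
rewrite (_ : partial a j _ x
  = \sum_l (partial a j (fun y => X a y 0 l) x * T a x [tuple l; i; m]
    + X a x 0 l * partial a j (fun y => T a y [tuple l; i; m]) x)); last exact:
      has_partialE hp.
transitivity (\sum_l ((\sum_p X a x 0 p * conn p j l) * T a x [tuple l; i; m]
  + partial a j (fun y => X a y 0 l) x * T a x [tuple l; i; m]
  + X a x 0 l * N j [tuple l; i; m])); last first.
  rewrite /iprod -big_split; apply: eq_bigr => l _ /=; congr (_ + _).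
  rewrite [row _ _ _ _]mxE [nablaX _ _]mxE -mulrDl; congr (_ * _).
  rewrite [RHS]addrC summxE; congr (_ + _); last by rewrite mxE.
  by apply: eq_bigr => p _; rewrite [RHS]mxE.
under [RHS]eq_bigr do rewrite /N cov_derivE act3E mulrBr.
transitivity (\sum_l (partial a j (fun y => X a y 0 l) x * T a x [tuple l; i; m]
    + X a x 0 l * partial a j (fun y => T a y [tuple l; i; m]) x)
  + (\sum_l (\sum_p X a x 0 p * conn p j l) * T a x [tuple l; i; m]
     - \sum_l X a x 0 l * \sum_p (conn j l p * T a x [tuple p; i; m]
       + conn j i p * T a x [tuple l; p; m] + conn j m p * T a x [tuple l; i; p])));
         last first.
  by rewrite -sumrB -big_split; apply: eq_bigr => l _ /=; ring.
congr (_ + _).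
have -> : \sum_l (\sum_p X a x 0 p * conn p j l) * T a x [tuple l; i; m] =
    \sum_l X a x 0 l * \sum_p conn j l p * T a x [tuple p; i; m].
  under eq_bigr do rewrite mulr_suml.
  rewrite exchange_big; apply: eq_bigr => l _; rewrite mulr_sumr.
  by apply: eq_bigr => p _; rewrite conn_sym mulrA.
rewrite -sumrB -sumrN.
transitivity (\sum_l \sum_p
  - (X a x 0 l * (conn j i p * T a x [tuple l; p; m]
    + conn j m p * T a x [tuple l; i; p]))).
  rewrite exchange_big; apply: eq_bigr => p _; rewrite sumrN; congr (- _).
  rewrite /iprod_field /iprod !mulr_sumr -big_split; apply: eq_bigr => l _ /=.
  by rewrite mulrDr; congr (_ + _); rewrite mulrCA.
apply: eq_bigr => l _; rewrite !mulr_sumr -sumrB; apply: eq_bigr => p _.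
by ring.
Qed.

Lemma cov_deriv_closed : closed_form T -> forall l i j k,
  N l [tuple i; j; k] - N i [tuple l; j; k] + N j [tuple l; i; k] - N k [tuple l; i; j]
    = 0.
Proof.
move=> cl l i j k.
have d0 : partial a l (fun y => T a y [tuple i; j; k]) x
    - partial a i (fun y => T a y [tuple l; j; k]) x
    + partial a j (fun y => T a y [tuple l; i; k]) x
    - partial a k (fun y => T a y [tuple l; i; j]) x = 0.
  have := cl a x ax [tuple l; i; j; k].
  have drop_r (r : 'I_4) (J : 3.-tuple 'I_n) :
      [seq tnth [tuple l; i; j; k] (lift r s) | s <- enum 'I_3] = J ->
      [tuple tnth [tuple l; i; j; k] (lift r s) | s < 3] = J.
    by move=> e; apply: val_inj.
  rewrite /ext_d !big_ord_recl big_ord0 addr0.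
  rewrite (drop_r _ [tuple i; j; k]); last by rewrite !enum_ordSl enum_ord0.
  rewrite (drop_r _ [tuple l; j; k]); last by rewrite !enum_ordSl enum_ord0.
  rewrite (drop_r _ [tuple l; i; k]); last by rewrite !enum_ordSl enum_ord0.
  rewrite (drop_r _ [tuple l; i; j]); last by rewrite !enum_ordSl enum_ord0.
  rewrite !exprS !expr0 !mulr1 !mulN1r !opprK => <-.
  by rewrite !addrA !mul1r !mulN1r.
have alt := alternating3P (sT.2 a x ax).
have comb (b1 b2 b3 b4 s1 s2 s3 s4 : R) : s1 - s2 + s3 - s4 = 0 ->
    b1 - b2 + b3 - b4 = 0 -> b1 - s1 - (b2 - s2) + (b3 - s3) - (b4 - s4) = 0.
  by move=> h1 h2; lra.
rewrite /N !cov_derivE !act3E; apply: comb d0.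
exact: (sum_torsion_free _ _ _ _ conn_sym alt).
Qed.

(** Differentiation in the chart yields connection terms of two kinds. Those on contracted slots and
    on the inverse metric cancel by [tr_derivative]; those on the free indices i, j reproduce,
    through the identity itself, the derivative of the right-hand side given by [conn_metric]. Only
    the covariant derivatives remain. *)
Lemma cov_deriv_trace :
  (forall y, dom a y -> forall i j,
    \tr (mat3 (T a y) i *m gram_inv (g a y) *m (mat3 (T a y) j)^T *m gram_inv (g a y))
    = 6 * gram (g a y) i j) ->
  forall l i j,
    \tr (mat3 (N l) i *m gram_inv (g a x) *m (mat3 (T a x) j)^T *m gram_inv (g a x))
    + \tr (mat3 (T a x) i *m gram_inv (g a x) *m (mat3 (N l) j)^T *m gram_inv (g a x))
      = 0.
Proof.
move=> trT l i j.
pose G := gram (g a x); pose h := gram_inv (g a x); pose S := conn l.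
pose dT i := mat3 (fun I => partial a l (fun y => T a y I) x) i.
have hT m : has_partial_mx a x l (fun y => mat3 (T a y) m) (dT m).
  move=> r s; rewrite mxE (_ : (fun y => _) = fun y => T a y [tuple m; r; s]).
    exact: has_partial_smooth (sT.1.2 a _).
  by apply/funext => y; rewrite mxE.
have hg : has_partial_mx a x l (fun y => gram (g a y)) (dgram l).
  move=> r s; rewrite mxE (_ : (fun y => _) = fun y => g a y [tuple r; s]).
    exact: has_partial_smooth (g_metric.1.2 a _).
  by apply/funext => y; rewrite mxE.
have hh := has_partial_invmx ax gram_unit hg.
have := has_partial_mxtrace (has_partial_mxM ax (has_partial_mxM ax (has_partial_mxM ax
  (hT i) hh) (has_partial_mx_tr (hT j))) hh).
have GT : G^T = G by exact: gram_sym.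
have Gh : G *m h = 1%:M by rewrite mulmxV // gram_unit.
have hG : h *m G = 1%:M by rewrite mulVmx // gram_unit.
have -> : - (invmx (gram (g a x)) *m dgram l *m invmx (gram (g a x))) =
  - (h *m S + S^T *m h).
  rewrite conn_metric -/G -/(gram_inv _) -/h; congr (- _).
  rewrite trmx_mul GT mulmxDr mulmxDl -!mulmxA Gh mulmx1; congr (_ + _).
  by rewrite [h *m (G *m _)]mulmxA hG mul1mx.
move=> /(has_partial_ext ax (fun y ay => trT y ay i j)) /has_partialE.
have -> : partial a l (fun y => 6 * gram (g a y) i j) x = 6 * dgram l i j.
  have := has_partialM ax (has_partial_cst a x l 6) (hg i j).
  by rewrite mul0r add0r => /has_partialE.
rewrite -/(gram_inv (g a x)) -/h.
(* The partial derivative is the covariant derivative plus the action of S on the two contracted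
   slots and on the free slot m. *)
have dTE m : dT m = mat3 (N l) m + (S *m mat3 (T a x) m + mat3 (T a x) m *m S^T)
    + \sum_p S m p *: mat3 (T a x) p.
  rewrite -addrA -mat3_act; apply/matrixP => r s.
  by rewrite mxE [RHS]mxE ![mat3 _ _ _ _]mxE /N cov_derivE subrK.
have Q p q : \tr (mat3 (T a x) p *m h *m (mat3 (T a x) q)^T *m h) = 6 * G p q.
  exact: trT.
rewrite !dTE tr_derivative mxtrace_suml mxtrace_sumr.
under [X in _ = _ + (X + _)]eq_bigr do rewrite Q.
under [X in _ = _ + (_ + X)]eq_bigr do rewrite Q.
have -> : \sum_p S i p * (6 * G p j) = 6 * (S *m G) i j.
  by rewrite mxE mulr_sumr; apply: eq_bigr => p _; rewrite mulrCA.
have -> : \sum_p S j p * (6 * G i p) = 6 * (S *m G) j i.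
  rewrite mxE mulr_sumr; apply: eq_bigr => p _; rewrite mulrCA.
  by rewrite -[in LHS]GT [G^T _ _]mxE.
rewrite conn_metric [X in 6 * X]mxE [X in _ + X]mxE mulrDr -/S -/G.
by move/eqP; rewrite addrC -subr_eq subrr eq_sym => /eqP.
Qed.

End ThreeForm.

End Connection.

(** * Both claims at a point of M *)

Section Pointwise.
Variables (R : realType) (M : topologicalType) (A : smooth_atlas R 7 M).
Variables (phi : tensor_field A 3) (g : tensor_field A 2) (vol : tensor_field A 7).
Variables (X : vector_field A).
Hypotheses (G2_phi : G2_structure phi) (closed_phi : closed_form phi)
  (G2_g : G2_metric phi g vol) (sX : smooth_vector_field X).
Variables (a : chart A) (x : M).
Hypothesis ax : dom a x.

Let dstar := codiff g (iprod_field X phi).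
Let H := nablaX g X a x *m gram (g a x) + (nablaX g X a x *m gram (g a x))^T.
Let delta : 'rV[R]_7 := \row_m dstar a x [tuple m].

Lemma gram_lie : gram (lie_derivative X g a x) = H.
Proof.
case: G2_g => gm _ _; apply/matrixP => i j.
by rewrite mxE (lie_derivative_g X gm ax).
Qed.

Lemma dstarE m : dstar a x [tuple m] = - \sum_i \sum_j gram_inv (g a x) i j *
  (iprod (row j (nablaX g X a x)) (phi a x) [tuple i; m]
   + iprod (X a x) (cov_deriv g phi a x j) [tuple i; m]).
Proof.
case: G2_g => gm _ _; congr (- _); apply: eq_bigr => i _; apply: eq_bigr => j _.
congr (_ * _); rewrite -(cov_deriv_iprod gm sX ax G2_phi.1).
by apply: (congr1 (cov_deriv _ _ _ _ _)); apply: val_inj.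
Qed.

Lemma lie_derivative_phi :
  (forall I, lie_derivative X phi a x I =
     2^-1 * act (H *m gram_inv (g a x)) (phi a x) I
     + 2^-1 * iprod (delta *m gram_inv (g a x)) (G2_dual phi g vol a x) I)
  /\ ((forall I, lie_derivative X phi a x I = 0) -> H = 0 /\ delta = 0).
Proof.
have [gm vf gvol] := G2_g.
have [u uu phi_u] := G2_phi.2 a x ax.
have gE := (frame_metric uu phi_u (gm.2 a x ax) (vf.2 a x ax) (gvol a x ax)).1.
have hE := frame_gram_inv uu phi_u (gm.2 a x ax) (vf.2 a x ax) (gvol a x ax).
have psiE := frame_hodge uu phi_u (gm.2 a x ax) (vf.2 a x ax) (gvol a x ax).
(* A frame is chosen anew at each [y]: the identity must hold around x in order to be differentiated
   there, whereas the algebra below uses only the frame at x. *)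
have trT y (ay : dom a y) i j : \tr (mat3 (phi a y) i *m gram_inv (g a y)
    *m (mat3 (phi a y) j)^T *m gram_inv (g a y)) = 6 * gram (g a y) i j.
  have [v vu phi_v] := G2_phi.2 a y ay.
  exact: (frame_trace vu phi_v (gm.2 a y ay) (vf.2 a y ay) (gvol a y ay)).
have altN := alternating_cov_deriv g ax G2_phi.1.
have clN := cov_deriv_closed gm ax G2_phi.1 closed_phi.
have metN := cov_deriv_trace gm ax G2_phi.1 trT.
rewrite hE in metN.
have tid := transport_identity uu phi_u psiE (X a x) (nablaX g X a x) altN clN metN.
have inj := transport_inj uu phi_u psiE (N := cov_deriv g phi a x)
  (X := X a x) (Z := nablaX g X a x).
rewrite -gE -hE in tid inj.
have dE : delta = \row_m - \sum_i \sum_j gram_inv (g a x) i j *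
    (iprod (row j (nablaX g X a x)) (phi a x) [tuple i; m]
     + iprod (X a x) (cov_deriv g phi a x j) [tuple i; m]).
  by apply/rowP => m; rewrite mxE dstarE mxE.
rewrite -dE in tid inj.
have lieE I : lie_derivative X phi a x I =
     2^-1 * act (H *m gram_inv (g a x)) (phi a x) I
     + 2^-1 * iprod (delta *m gram_inv (g a x)) (G2_dual phi g vol a x) I.
  by rewrite (lie_derivativeE g) tid.
split=> // lie0; apply: inj => I.
have := lie0 I; rewrite lieE -mulrDr => /eqP.
by rewrite mulf_eq0 invr_eq0 pnatr_eq0 => /eqP.
Qed.

End Pointwise.

Theorem lemma9p3 (R : realType) (M : topologicalType) (A : smooth_atlas R 7 M)
    (phi : tensor_field A 3) (g : tensor_field A 2) (vol : tensor_field A 7)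
    (X : vector_field A) :
  compact_manifold M ->
  G2_structure phi -> closed_form phi -> G2_metric phi g vol ->
  smooth_vector_field X ->
  let psi := G2_dual phi g vol in
  let dstar := codiff g (iprod_field X phi) in
  eq_field (lie_derivative X phi)
    (fun a x I => 2^-1 * i_field g phi (lie_derivative X g) a x I
                  + 2^-1 * iprod_field (sharp_field g dstar) psi a x I)
  /\
  (vanishes (lie_derivative X phi) -> killing g X /\ vanishes dstar).
Proof.
move=> _ G2_phi cl G2_g sX psi dstar; split=> [a x ax I|lie0].
  rewrite (lie_derivative_phi G2_phi cl G2_g sX ax).1; congr (_ * _ + _ * _).
    by rewrite /i_field (i_map_act _ _ (G2_phi.1.2 a x ax)) (gram_lie _ G2_g ax).
  have [gm _ _] := G2_g.
  rewrite /iprod_field /sharp_field /sharp; congr (iprod _ _ I).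
  have hT : (gram_inv (g a x))^T = gram_inv (g a x).
    by rewrite /gram_inv trmx_inv (gram_sym gm ax).
  apply/rowP => i; rewrite [LHS]mxE [RHS]mxE; apply: eq_bigr => j _.
  by rewrite mulrC -[in LHS]hT !mxE.
have pt a x (ax : dom a x) := (lie_derivative_phi G2_phi cl G2_g sX ax).2 (lie0 a x ax).
split=> a x ax.
  apply: tuple2P => i j; have := gram_lie X G2_g ax; rewrite (pt a x ax).1.
  by move/matrixP/(_ i j); rewrite !mxE.
by apply: tuple1P => m; have /rowP/(_ m) := (pt a x ax).2; rewrite !mxE.
Qed.
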